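(* Let $X\subset Q$ be a zero-dimensional scheme with $\Delta M_X$ of size $(a,b)$. Let $R$ be a $(1,0)$-line disjoint from $X$. Let $C_{b+1},\dots,C_n$, $n\ge b$, be arbitrary $(0,1)$-lines, pairwise distinct and distinct from $C_0,\dots,C_b$, and let $i_1,\dots,i_r\in\{0,\dots,b\}$ be pairwise distinct. Let $\mathcal P=\{R\cap C_i\mid i\in\{0,\dots,n\},\ i\neq i_1,\dots,i_r\}$ and let $W=X\cup\mathcal P$. Suppose also that on the $(0,1)$-line $C_{i_k}$ there are $q_k$ points of $X$ (that is, $q_k=\#(X\cap C_{i_k})$) for $k=1,\dots,r$ and that $q_1\le q_2\le\dots\le q_r$. Put $T=\{(q_1,n),(q_2,n-1),\dots,(q_r,n-r+1)\}$. Then $$\Delta M_W^{(i,j)}=\begin{cases}1&\text{if }i=0,\ j\le n\\0&\text{if }i=0,\ j\ge n+1\\ \Delta M_X^{(i-1,j)}&\text{if }i\ge1\text{ and }(i,j)\notin T\\ \Delta M_X^{(i-1,j)}-1&\text{if }i\ge1\text{ and }(i,j)\in T\end{cases}$$ for all $i,j\ge 0$, if one of the following conditions holds: 1. $r=1$; 2. $r\ge2$ and for any $k\in\{2,\dots,r\}$ and $i\ge q_k$, $\Delta M_X^{(i,n-k+2)}=0$.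
   Context: Let $k$ be an algebraically closed field, $Q=\mathbb P^1_k\times\mathbb P^1_k$, and $S=\bigoplus_{i,j\ge 0}H^0(Q,\mathcal O_Q(i,j))$ the bigraded coordinate ring. A $(1,0)$-line (resp. $(0,1)$-line) is the zero locus of a nonzero form of bidegree $(1,0)$ (resp. $(0,1)$). For a zero-dimensional scheme $X\subset Q$ let $I(X)\subset S$ be its saturated ideal. The Hilbert matrix of $X$ is $M_X^{(i,j)}=M_X(i,j)=\dim_k(S/I(X))_{i,j}$ ($=0$ if $i<0$ or $j<0$), and its first difference is $\Delta M_X^{(i,j)}=M_X(i,j)-M_X(i-1,j)-M_X(i,j-1)+M_X(i-1,j-1)$. Put $a=\min\{i: I(X)_{i,0}\neq0\}-1$, $b=\min\{j: I(X)_{0,j}\ne0\}-1$; then $\Delta M_X$ is said to be of size $(a,b)$. $R_0,\dots,R_a$ and $C_0,\dots,C_b$ denote, respectively, the $(1,0)$-lines and the $(0,1)$-lines containing $X$, each of them containing at least one point of $X$. For a line $L$ defined by a form $l$, $\#(X\cap L)$ denotes the degree of the scheme defined by the saturation of $(I(X),l)$ (the number of points of $X$ on $L$); $L$ is disjoint from $X$ if $\#(X\cap L)=0$.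
   Formalization: The (0,1)-lines C_0,…,C_b are taken to be pairwise distinct, with X contained in their union (so the least-degree form in I(X)_{0,*} has no repeated factor); if these lines are counted with multiplicity the formula fails. *)

(* Defs.v *)
From HB Require Import structures.
From mathcomp Require Import all_boot all_order all_algebra.
From mathcomp Require Import mpoly.
From Stdlib Require Import Classical ClassicalEpsilon.
Set Implicit Arguments. Unset Strict Implicit. Unset Printing Implicit Defensive.
Import Order.TTheory GRing.Theory Num.Theory.
Local Open Scope ring_scope.

(** The bigraded coordinate ring of Q = P^1 x P^1 is k[x0, x1, y0, y1]: the
    variables of index 0, 1 are x0, x1, of bidegree (1, 0), and those of index
    2, 3 are y0, y1, of bidegree (0, 1). *)

Notation coord_ring k := {mpoly k[4]}.

Definition degx (m : 'X_{1..4}) : nat := (\sum_(t < 4 | (t < 2)%N) m t)%N.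
Definition degy (m : 'X_{1..4}) : nat := (\sum_(t < 4 | (2 <= t)%N) m t)%N.

Fact degx0 : degx 0%MM = 0%N.
Proof. by apply: big1 => t _; rewrite mnm0E. Qed.

Fact degxD : {morph degx : m1 m2 / (m1 + m2)%MM >-> (m1 + m2)%N}.
Proof.
by move=> m1 m2; rewrite /degx -big_split; apply: eq_bigr => t _; rewrite mnmDE.
Qed.

Fact degy0 : degy 0%MM = 0%N.
Proof. by apply: big1 => t _; rewrite mnm0E. Qed.

Fact degyD : {morph degy : m1 m2 / (m1 + m2)%MM >-> (m1 + m2)%N}.
Proof.
by move=> m1 m2; rewrite /degy -big_split; apply: eq_bigr => t _; rewrite mnmDE.
Qed.

HB.instance Definition _ := isMeasure.Build 4 degx degx0 degxD.
HB.instance Definition _ := isMeasure.Build 4 degy degy0 degyD.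

Section Ring.

Variable k : closedFieldType.
Local Notation S := (coord_ring k).

Definition bihom (i j : nat) (F : S) : bool :=
  (F \is i.-homog for degx) && (F \is j.-homog for degy).

Definition bipart (i j : nat) (F : S) : S :=
  pihomog degx i (pihomog degy j F).

Definition ideal (I : S -> Prop) : Prop :=
  [/\ I 0, forall F G, I F -> I G -> I (F + G) & forall F G, I G -> I (F * G)].

Definition bihomogeneous (I : S -> Prop) : Prop :=
  forall i j F, I F -> I (bipart i j F).

(** The forms of bidegree (N, N) generate the N-th power of the irrelevant
    ideal (x0, x1)(y0, y1). *)
Definition saturation (I : S -> Prop) (F : S) : Prop :=
  exists N : nat, forall G, bihom N N G -> I (G * F).

(** Closed subschemes of Q correspond bijectively to bihomogeneous ideals that
    are saturated with respect to the irrelevant ideal; X is represented by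
    I(X), and [X F] reads F \in I(X). *)
Record subscheme := Subscheme {
  ideal_of :> S -> Prop;
  ideal_ofP : ideal ideal_of;
  ideal_of_bihom : bihomogeneous ideal_of;
  ideal_of_sat : forall F, saturation ideal_of F -> ideal_of F }.

(** A closed point of Q, by homogeneous coordinates ([x0 : x1], [y0 : y1]). *)
Record qpoint := QPoint {
  coords :> 'I_4 -> k;
  coords_x : exists2 t : 'I_4, (t < 2)%N & coords t != 0;
  coords_y : exists2 t : 'I_4, (2 <= t)%N & coords t != 0 }.

Definition same_point (p p' : qpoint) : Prop :=
  exists u v : k, [/\ u != 0, v != 0 &
    forall t : 'I_4, p' t = (if (t < 2)%N then u else v) * p t].

Definition on_scheme (X : subscheme) (p : qpoint) : Prop :=
  forall F, X F -> F.@[p] = 0.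

Definition zero_dimensional (X : subscheme) : Prop :=
  (exists p, on_scheme X p) /\
  exists (m : nat) (e : 'I_m -> qpoint),
    forall p, on_scheme X p -> exists t, same_point (e t) p.

(** The classes of e_0, ..., e_(d-1) form a k-basis of (S/I)_{i,j}. *)
Definition quotient_basis (I : S -> Prop) (i j d : nat) (e : 'I_d -> S) : Prop :=
  [/\ forall t, bihom i j (e t),
      forall a : 'I_d -> k, I (\sum_t a t *: e t) -> forall t, a t = 0
    & forall F, bihom i j F -> exists a : 'I_d -> k, I (F - \sum_t a t *: e t)].

(** dim_k (S/I)_{i,j}; see [quotient_dimP] and [quotient_dim_uniq]. *)
Definition quotient_dim (I : S -> Prop) (i j : nat) : nat :=
  epsilon (inhabits 0%N)
    (fun d => exists e : 'I_d -> S, quotient_basis I i j e).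

Lemma idealZ (I : S -> Prop) c F : ideal I -> I F -> I (c *: F).
Proof. by case=> _ _ IM IF; rewrite -mul_mpolyC; apply: IM. Qed.

Lemma ideal_sum (I : S -> Prop) (T : finType) (E : T -> S) :
  ideal I -> (forall t, I (E t)) -> I (\sum_t E t).
Proof. by case=> I0 ID _ IE; elim/big_ind: _ => [//|F G|t _]; [apply: ID|]. Qed.

Lemma free_le_span (I : S -> Prop) (d d' : nat) (e : 'I_d -> S) (e' : 'I_d' -> S) :
    ideal I ->
    (forall a : 'I_d -> k, I (\sum_t a t *: e t) -> forall t, a t = 0) ->
    (forall t, exists a : 'I_d' -> k, I (e t - \sum_s a s *: e' s)) ->
  (d <= d')%N.
Proof.
move=> idI free_e span_e; rewrite leqNgt; apply/negP => lt_d'd.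
pose c t := proj1_sig (constructive_indefinite_description _ (span_e t)).
have cP t : I (e t - \sum_s c t s *: e' s) :=
  proj2_sig (constructive_indefinite_description _ (span_e t)).
pose A := \matrix_(t < d, s < d') c t s.
have ker_neq0 : kermx A != 0.
  rewrite -mxrank_eq0 mxrank_ker subn_eq0 -ltnNge.
  exact: leq_ltn_trans (rank_leq_col A) lt_d'd.
pose u := nz_row (kermx A).
have uA0 : u *m A = 0 by apply/sub_kermxP/nz_row_sub.
have u_neq0 : u != 0 by rewrite nz_row_eq0.
case/eqP: u_neq0; apply/rowP => t; rewrite mxE.
apply: (free_e (fun t => u 0 t)).
have -> : \sum_t u 0 t *: e t =
    \sum_t u 0 t *: (e t - \sum_s c t s *: e' s).
  under [RHS]eq_bigr do rewrite scalerBr scaler_sumr.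
  rewrite sumrB exchange_big /= [X in _ - X]big1 ?subr0 // => s _.
  under eq_bigr do rewrite scalerA.
  rewrite -scaler_suml; have /rowP/(_ s) := uA0; rewrite !mxE.
  by under eq_bigr do rewrite mxE; move=> ->; rewrite scale0r.
by apply: ideal_sum => // t'; apply: idealZ.
Qed.

Lemma bihom_span (i j : nat) :
  exists (N : nat) (e : 'I_N -> S), forall F, bihom i j F ->
    exists a : 'I_N -> k, F = \sum_t a t *: e t.
Proof.
pose T : finType := 'X_{1..4 < (i + j).+1}.
exists #|T|, (fun t => 'X_[enum_val t : T]) => F /andP[/dhomogP hx /dhomogP hy].
exists (fun t => F@_(enum_val t : T)).
have sz : (msize F <= (i + j).+1)%N.
  rewrite msizeE; apply/bigmax_leqP_seq => m mF _.
  rewrite ltnS -(hx _ mF) -(hy _ mF) mdegE (bigID (fun t : 'I_4 => (t < 2)%N)) /=.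
  by rewrite /degy; under [in leqRHS]eq_bigl do rewrite leqNgt.
by rewrite {1}(mpolywE sz) (reindex _ (onW_bij _ (enum_val_bij T))).
Qed.

Lemma quotient_dim_uniq (I : S -> Prop) (i j d d' : nat)
    (e : 'I_d -> S) (e' : 'I_d' -> S) : ideal I ->
  quotient_basis I i j e -> quotient_basis I i j e' -> d = d'.
Proof.
move=> idI [he fe se] [he' fe' se']; apply/eqP; rewrite eqn_leq; apply/andP.
have h t := se' _ (he t); have h' t := se _ (he' t).
by rewrite (free_le_span idI fe h) (free_le_span idI fe' h').
Qed.

Lemma quotient_dimP (I : S -> Prop) (i j : nat) : ideal I ->
  exists e : 'I_(quotient_dim I i j) -> S, quotient_basis I i j e.
Proof.
move=> idI; rewrite /quotient_dim; apply: (@epsilon_spec nat (inhabits 0%N)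
  (fun d => exists e : 'I_d -> S, quotient_basis I i j e)).
pose free m := exists e : 'I_m -> S, (forall t, bihom i j (e t)) /\
  (forall a : 'I_m -> k, I (\sum_t a t *: e t) -> forall t, a t = 0).
pose freeb m : bool := if excluded_middle_informative (free m) then true else false.
have freeP m : reflect (free m) (freeb m).
  by rewrite /freeb; case: excluded_middle_informative => h; constructor.
have [N [e' span_e']] := bihom_span i j.
have ex_free : exists m, freeb m.
  by exists 0%N; apply/freeP; exists (fun=> 0); split=> [[]|a _ []].
have bound m : freeb m -> (m <= N)%N.
  case/freeP=> e [he fe]; apply: (@free_le_span I _ _ e e' idI fe) => t.
  by have [a ->] := span_e' _ (he t); exists a; rewrite subrr; case: idI.
case: (ex_maxnP ex_free bound) => d /freeP[e [he fe]] max_d.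
exists d, e; split=> // F hF; apply: NNPP => no_a.
suff: freeb d.+1 by move/max_d; rewrite ltnn.
apply/freeP; exists (fun t => oapp e F (unlift ord0 t)); split=> [t|a].
  by case: (unliftP ord0 t) => [t' _|_] /=; [exact: he | exact: hF].
rewrite big_ord_recl unlift_none /=.
under eq_bigr do rewrite liftK /=.
have [a0|a0] := eqVneq (a ord0) 0.
  rewrite a0 scale0r add0r => /(fe (fun t => a (lift ord0 t))) h t.
  by case: (unliftP ord0 t) => [t' ->|-> //]; exact: h.
move=> Ia; case: no_a; exists (fun t => - ((a ord0)^-1 * a (lift ord0 t))).
have := idealZ (a ord0)^-1 idI Ia.
rewrite scalerDr scalerA mulVf // scale1r scaler_sumr.
under eq_bigr do rewrite scalerA.
by under [in X in _ -> X]eq_bigr do rewrite scaleNr; rewrite sumrN opprK.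
Qed.

Definition hilbert_matrix (X : subscheme) (i j : int) : int :=
  match i, j with
  | Posz i', Posz j' => (quotient_dim X i' j')%:Z
  | _, _ => 0
  end.

Definition hilbert_diff (X : subscheme) (i j : int) : int :=
  hilbert_matrix X i j - hilbert_matrix X (i - 1) j
  - hilbert_matrix X i (j - 1) + hilbert_matrix X (i - 1) (j - 1).

Definition nonzero_part (X : subscheme) (i j : nat) : Prop :=
  exists F, [/\ X F, bihom i j F & F != 0].

(** The two minima are a + 1 and b + 1. *)
Definition diff_size (X : subscheme) (a b : nat) : Prop :=
  [/\ nonzero_part X a.+1 0, forall i, nonzero_part X i 0 -> (a < i)%N,
      nonzero_part X 0 b.+1 & forall j, nonzero_part X 0 j -> (b < j)%N].

(** A line is given by an equation; lines are compared by their loci. *)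
Definition line10 (l : S) : Prop := bihom 1 0 l /\ l != 0.
Definition line01 (l : S) : Prop := bihom 0 1 l /\ l != 0.

Definition same_locus (l l' : S) : Prop :=
  forall p : qpoint, l.@[p] = 0 <-> l'.@[p] = 0.

Definition section_ideal (X : subscheme) (l : S) : S -> Prop :=
  saturation (fun F => exists G H, X G /\ F = G + H * l).

(** The zero-dimensional (or empty) subscheme of Q with saturated ideal I has
    degree d: its Hilbert function is eventually d. *)
Definition has_degree (I : S -> Prop) (d : nat) : Prop :=
  exists N : nat, forall i j : nat, (N <= i)%N -> (N <= j)%N ->
    quotient_dim I i j = d.

(** #(X \cap L) = d, for the line L of equation l. *)
Definition points_on_line (X : subscheme) (l : S) (d : nat) : Prop :=
  has_degree (section_ideal X l) d.

Definition disjoint_line (X : subscheme) (l : S) : Prop :=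
  points_on_line X l 0.

Fact union_ideal (X Y : subscheme) : ideal (fun F => X F /\ Y F).
Proof.
have [[X0 XD XM] [Y0 YD YM]] := (ideal_ofP X, ideal_ofP Y).
split=> [//|F G [XF YF] [XG YG]|F G [XG YG]]; split.
- exact: XD. - exact: YD. - exact: XM. - exact: YM.
Qed.

Fact union_bihom (X Y : subscheme) : bihomogeneous (fun F => X F /\ Y F).
Proof. by move=> i j F [XF YF]; split; apply: ideal_of_bihom. Qed.

Fact union_sat (X Y : subscheme) (F : S) :
  saturation (fun F => X F /\ Y F) F -> X F /\ Y F.
Proof.
by case=> N h; split; apply: ideal_of_sat; exists N => G /h [].
Qed.

Definition union (X Y : subscheme) : subscheme :=
  Subscheme (union_ideal X Y) (@union_bihom X Y) (@union_sat X Y).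

Fact bipart_is_linear (i j : nat) : linear (bipart i j).
Proof. by move=> a F G; rewrite /bipart !linearP. Qed.

HB.instance Definition _ (i j : nat) :=
  GRing.isLinear.Build k S S _ (bipart i j) (bipart_is_linear i j).

Lemma bipartE (i j : nat) (F G : S) : bipart i j (F * G) =
  \sum_(m <- msupp F) F@_m *: bipart i j ('X_[m] * G).
Proof.
rewrite {1}[F]mpolyE mulr_suml (linear_sum (bipart i j)).
by apply: eq_bigr => m _; rewrite -scalerAl (linearZ_LR (bipart i j)).
Qed.

Lemma bipartM (m : 'X_{1..4}) (i j : nat) (F : S) :
  bipart i j ('X_[m] * F) =
  if (degx m <= i)%N && (degy m <= j)%N
  then 'X_[m] * bipart (i - degx m) (j - degy m) F else 0.
Proof.
have gen (mf : measure 4) d (G : S) : pihomog mf d ('X_[m] * G) =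
    if (mf m <= d)%N then 'X_[m] * pihomog mf (d - mf m) G else 0.
  rewrite [G]mpolyE mulr_sumr !linear_sum /= mulr_sumr.
  have -> : (if (mf m <= d)%N then
      \sum_(i0 <- msupp G) 'X_[m] * pihomog mf (d - mf m) (G@_i0 *: 'X_[i0]) else 0)
    = \sum_(i0 <- msupp G) (if (mf m <= d)%N then
         'X_[m] * pihomog mf (d - mf m) (G@_i0 *: 'X_[i0]) else 0).
    by case: ifP => // _; rewrite big1.
  apply: eq_bigr => m' _; rewrite -scalerAr -mpolyXD !linearZ /= !pihomogX mfD.
  case: (leqP (mf m) d) => h.
    rewrite -(eqn_add2l (mf m) (mf m')) subnKC //.
    by case: ifP => _; rewrite ?mulr0 ?scaler0 ?mpolyXD ?scalerAr // mulr0.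
  by rewrite gtn_eqF ?scaler0 // (leq_trans h) // leq_addr.
rewrite /bipart gen; case: (leqP (degy m) j) => hj; last first.
  by rewrite andbF linear0.
by rewrite andbT gen.
Qed.

(** The ideal generated by the bihomogeneous forms vanishing on P. *)
Definition points_ideal (P : qpoint -> Prop) (F : S) : Prop :=
  forall p, P p -> forall i j, (bipart i j F).@[p] = 0.

Fact points_is_ideal (P : qpoint -> Prop) : ideal (points_ideal P).
Proof.
split=> [p _ i j|F G hF hG p Pp i j|F G hG p Pp i j].
- by rewrite /bipart !linear0.
- by rewrite (linearD (bipart i j)) mevalD hF // hG // addr0.
- rewrite bipartE raddf_sum big1 //= => m _; rewrite mevalZ bipartM.
  by case: ifP => _; rewrite ?mevalM ?hG // ?meval0 ?mulr0 // mulr0.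
Qed.

Lemma bipartX (i j : nat) (m : 'X_{1..4}) :
  bipart i j ('X_[m] : S) =
  if (degx m == i) && (degy m == j) then 'X_[m] else 0.
Proof.
rewrite /bipart pihomogX; case: (degy m == j); last by rewrite andbF linear0.
by rewrite pihomogX andbT.
Qed.

Lemma bipart_bipart (i j i' j' : nat) (F : S) :
  bipart i j (bipart i' j' F) =
  if (i == i') && (j == j') then bipart i j F else 0.
Proof.
have F1 : F = F * 1 by rewrite mulr1.
have -> : bipart i' j' F = \sum_(m <- msupp F) F@_m *: bipart i' j' 'X_[m].
  by rewrite {1}F1 bipartE; apply: eq_bigr => m _; rewrite mulr1.
have -> : bipart i j F = \sum_(m <- msupp F) F@_m *: bipart i j 'X_[m].
  by rewrite {1}F1 bipartE; apply: eq_bigr => m _; rewrite mulr1.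
rewrite (linear_sum (bipart i j)).
have -> (b : bool) (H : 'X_{1..4} -> S) :
    (if b then \sum_(m <- msupp F) H m else 0)
      = \sum_(m <- msupp F) (if b then H m else 0).
  by case: b => //; rewrite big1.
apply: eq_bigr => m _; rewrite (linearZ_LR (bipart i j)) /= !bipartX.
have [<-|nx] := eqVneq (degx m) i'; last first.
  rewrite /= (linear0 (bipart i j)) scaler0; case: ifP => // /andP[/eqP e _].
  by rewrite e (negPf nx) scaler0.
have [<-|ny] := eqVneq (degy m) j'; last first.
  rewrite /= (linear0 (bipart i j)) scaler0; case: ifP => // /andP[_ /eqP e].
  by rewrite e (negPf ny) andbF scaler0.
rewrite /= bipartX [i == _]eq_sym [j == _]eq_sym.
by case: ifP => //; rewrite scaler0.
Qed.

Fact points_bihom (P : qpoint -> Prop) : bihomogeneous (points_ideal P).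
Proof.
move=> i j F hF p Pp i' j'; rewrite bipart_bipart.
by case: ifP => _; [exact: hF | exact: meval0].
Qed.

Fact points_sat (P : qpoint -> Prop) (F : S) :
  saturation (points_ideal P) F -> points_ideal P F.
Proof.
case=> N hN p Pp i j.
have [[t t2 pt] [u u2 pu]] := (coords_x p, coords_y p).
pose m := ((U_(t) *+ N) + (U_(u) *+ N))%MM.
have tu : t != u by apply: contraTneq t2 => ->; rewrite -leqNgt.
have dx : degx m = N.
  rewrite /degx (bigD1 t) //= big1 => [|v /andP[v2 vt]].
    by rewrite addn0 mnmDE !mulmnE !mnm1E eqxx eq_sym (negPf tu) mul1n mul0n addn0.
  rewrite mnmDE !mulmnE !mnm1E [t == v]eq_sym (negPf vt).
  by case: eqVneq v2 => [<-|_ _]; [rewrite ltnNge u2 | rewrite !mul0n].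
have dy : degy m = N.
  rewrite /degy (bigD1 u) //= big1 => [|v /andP[v2 vu]].
    by rewrite addn0 mnmDE !mulmnE !mnm1E eqxx (negPf tu) mul1n mul0n.
  rewrite mnmDE !mulmnE !mnm1E [u == v]eq_sym (negPf vu).
  by case: eqVneq v2 => [<-|_ _]; [rewrite leqNgt t2 | rewrite !mul0n].
have hm : bihom N N ('X_[m] : S) by rewrite /bihom !dhomogX /= dx dy eqxx.
have /eqP := hN _ hm p Pp (N + i)%N (N + j)%N.
rewrite bipartM dx dy !leq_addr !addKn mevalM mulf_eq0 => /orP[|/eqP //].
rewrite mpolyXD -!mpolyXn mevalM !rmorphXn /= !mevalXU mulf_eq0 !expf_eq0.
by rewrite (negPf pt) (negPf pu) !andbF.
Qed.

Definition reduced_points (P : qpoint -> Prop) : subscheme :=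
  Subscheme (points_is_ideal P) (@points_bihom P) (@points_sat P).

End Ring.

(* Main.v *)
Require Import Defs.
From mathcomp Require Import all_boot all_order all_algebra.
From mathcomp Require Import mpoly zify ring.
From Stdlib Require Import Classical.
Set Implicit Arguments. Unset Strict Implicit. Unset Printing Implicit Defensive.
Import Order.TTheory GRing.Theory Num.Theory.
Local Open Scope ring_scope.

(** The idea is to restrict everything to the line R, of equation rho.

    As R does not meet X, rho is a nonzerodivisor modulo I(X); as the added
    points lie on R, I(W) : rho = I(X). Multiplication by rho then gives
      M_W(i, j) = M_X(i - 1, j) + dim (S / (I(W) + (rho)))_(i, j),
    so that the difference table of W is that of X moved by one row, plus that
    of S / (I(W) + (rho)), a quotient of the coordinate ring of R = P^1.

    This quotient is identified in each bidegree (i, j) ([union_restrict]):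
    I(W) + (rho) consists of the multiples, modulo rho, of the product of all
    the C_t except the C_(i_k) with q_k <= i. Its dimension is therefore
    min(j + 1, m_i), with m_i = n + 1 - #{k : q_k <= i}, and the correction to
    the moved table is [j < m_i] - [j < m_(i-1)]. The q_k being sorted, this
    is -1 exactly on the pairs (q_k, n - k + 1).

    One inclusion holds without any assumption on the difference table of X: a
    form of I(W) vanishes at the added points, and if i < q_k, a form of degree
    i in x which contains the q_k points of X on C_(i_k) is divisible by the
    equation of C_(i_k) ([scheme_line_dvd]).

    For the other one, it must be shown that the product of the C_t that are
    not in a given set of lines C_(i_k) with q_k <= i can be lifted, modulo
    rho, to I(X) ([lines_off_restrict]). If this set has one element, the
    section of X by C_(i_k) lies on a union of (1, 0)-lines of degree q_k that
    does not contain R ([section_add_rho]). In general the proof goes by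
    induction on the number m of lines in the set. The vanishing of the
    difference table of X at (i, n - m + 2) says that the pieces of bidegree
    (i, n - m + 1) and (i, n - m + 2) of S / (I(X) + (rho)) have the same
    dimension. Multiplication by a general form eta of bidegree (0, 1) is
    surjective between them, because modulo eta the target has dimension at most
    one and, by induction, a generator of it lies in I(X) + (rho); hence it is
    injective. As eta is a combination of two of the lines of the set,
    eta times the product lies in I(X) + (rho) by induction, and thus the
    product does ([lines_off_restrict_step]).

    All dimensions come from the exact sequence
      0 -> S / (I : l) -> S / I -> S / (I + (l)) -> 0
    for a bihomogeneous form l ([quotient_dim_exact]). *)

(** * Bihomogeneous forms *)

Section Forms.

Variable k : closedFieldType.
Local Notation S := (coord_ring k).
Implicit Types (F G H l : S) (I : S -> Prop) (m : 'X_{1..4}).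

Lemma degxE m : degx m = (m 0%R + m 1%R)%N.
Proof.
rewrite /degx big_mkcond !big_ord_recl big_ord0 /= !addn0.
by congr (m _ + m _)%N; apply: val_inj.
Qed.

Lemma degyE m : degy m = (m 2%R + m 3%R)%N.
Proof.
rewrite /degy big_mkcond !big_ord_recl big_ord0 /= !add0n addn0.
by congr (m _ + m _)%N; apply: val_inj.
Qed.

Lemma mdeg_degxy m : mdeg m = (degx m + degy m)%N.
Proof.
rewrite mdegE (bigID (fun t : 'I_4 => (t < 2)%N)) /=; congr addn.
by apply: eq_bigl => t; rewrite -leqNgt.
Qed.

Lemma bihomP i j F :
  reflect {in msupp F, forall m, degx m = i /\ degy m = j} (bihom i j F).
Proof.
apply: (iffP andP) => [[/dhomogP hx /dhomogP hy] m mF|h].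
  by split; [exact: hx | exact: hy].
by split; apply/dhomogP => m /h[].
Qed.

(** Forms of a given bidegree are spanned by monomials, so that a linear
    property of forms has to be checked on monomials only. *)
Lemma bihom_ind i j (P : S -> Prop) :
  P 0 -> (forall F G, P F -> P G -> P (F + G)) ->
  (forall e m, degx m = i -> degy m = j -> P (e *: 'X_[m])) ->
  forall F, bihom i j F -> P F.
Proof.
move=> P0 PD PX F /bihomP hF; rewrite [F]mpolyE big_seq.
by apply: big_ind => // m /hF[]; apply: PX.
Qed.

Lemma bihom0 i j : bihom i j (0 : S).
Proof. by rewrite /bihom !rpred0. Qed.

Lemma bihomD i j F G : bihom i j F -> bihom i j G -> bihom i j (F + G).
Proof. by case/andP=> ? ? /andP[? ?]; rewrite /bihom !rpredD. Qed.

Lemma bihomZ i j e F : bihom i j F -> bihom i j (e *: F).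
Proof. by case/andP=> ? ?; rewrite /bihom !rpredZ. Qed.

Lemma bihomB i j F G : bihom i j F -> bihom i j G -> bihom i j (F - G).
Proof. by case/andP=> ? ? /andP[? ?]; rewrite /bihom !rpredB. Qed.

Lemma bihom_sum i j (T : finType) (E : T -> S) :
  (forall t, bihom i j (E t)) -> bihom i j (\sum_t E t).
Proof.
by move=> hE; apply: (big_ind (bihom i j)); [exact: bihom0 | exact: bihomD |].
Qed.

Lemma bihomM i j i' j' F G :
  bihom i j F -> bihom i' j' G -> bihom (i + i') (j + j') (F * G).
Proof. by case/andP=> ? ? /andP[? ?]; rewrite /bihom !dhomogM. Qed.

Lemma bihomX i j m : degx m = i -> degy m = j -> bihom i j ('X_[m] : S).
Proof. by move=> <- <-; rewrite /bihom !dhomogX !eqxx. Qed.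

Lemma bihom1 : bihom 0 0 (1 : S).
Proof. by rewrite /bihom !dhomog1. Qed.

Lemma bihom_prod01 (T : finType) (A : {pred T}) (E : T -> S) :
  (forall t, bihom 0 1 (E t)) -> bihom 0 #|A| (\prod_(t in A) E t).
Proof.
move=> hE; rewrite -sum1_card.
by elim/big_rec2: _ => [|t F d _ hF]; [exact: bihom1 | exact: (bihomM (hE t) hF)].
Qed.

Lemma bipart_bihom i j F : bihom i j F -> bipart i j F = F.
Proof. by case/andP=> hx hy; rewrite /bipart !pihomog_dE. Qed.

Lemma bipart_bihom_neq i j i' j' F :
  bihom i j F -> ((i', j') == (i, j)) = false -> bipart i' j' F = 0.
Proof.
move=> /bipart_bihom <-; rewrite bipart_bipart.
by move=> h; rewrite -[_ && _]/((i', j') == (i, j)) h.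
Qed.

Lemma bihom_bipart i j F : bihom i j (bipart i j F).
Proof.
rewrite -[F]mulr1 bipartE; apply: (big_ind (bihom i j)).
- exact: bihom0. - exact: bihomD.
move=> m _; rewrite mulr1 bipartX; case: ifP => [/andP[/eqP <- /eqP <-]|_].
  exact/bihomZ/bihomX.
by rewrite scaler0 bihom0.
Qed.

(** Bihomogeneous components of multiples of a form l come from components of
    the cofactor; this is what makes the ideals below bihomogeneous. *)
Lemma bipartM_bihom a b l i j F : bihom a b l ->
  bipart i j (F * l) =
  if (a <= i)%N && (b <= j)%N then bipart (i - a) (j - b) F * l else 0.
Proof.
move=> /bihomP hl; rewrite mulrC bipartE big_seq.
under eq_bigr => m /hl[dx dy] do rewrite bipartM dx dy.
case: ifP => _; last by rewrite big1 // => m _; rewrite scaler0.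
rewrite [in RHS]mulrC [X in _ = X * _]mpolyE mulr_suml [in RHS]big_seq.
by apply: eq_bigr => m _; rewrite scalerAl.
Qed.

(** S_(i', j') is spanned by S_(i, j) as soon as i <= i' and j <= j'. *)
Lemma mnm_split m i j : (i <= degx m)%N -> (j <= degy m)%N ->
  exists m1 m2, [/\ m = (m1 + m2)%MM, degx m1 = i & degy m1 = j].
Proof.
rewrite degxE degyE => hi hj.
pose f (t : 'I_4) := nth 0%N [:: minn (m 0%R) i; i - minn (m 0%R) i;
  minn (m 2%R) j; j - minn (m 2%R) j]%N t.
have f_le t : (f t <= m t)%N.
  rewrite /f; case: t => [[|[|[|[|t]]]] lt_t] //=.
  - rewrite (_ : Ordinal _ = 0) ?geq_minl //; exact: val_inj.
  - rewrite (_ : Ordinal _ = 1); last exact: val_inj. lia.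
  - rewrite (_ : Ordinal _ = 2) ?geq_minl //; exact: val_inj.
  - rewrite (_ : Ordinal _ = 3); last exact: val_inj. lia.
exists [multinom f t | t < 4], (m - [multinom f t | t < 4])%MM.
split.
- rewrite addmC submK //; apply/mnm_lepP => t; rewrite mnmE; exact: f_le.
- rewrite degxE !mnmE /f /=; lia.
- rewrite degyE !mnmE /f /=; lia.
Qed.

End Forms.

(** * Ideals, colons and saturation *)

Section Ideals.

Variable k : closedFieldType.
Local Notation S := (coord_ring k).
Implicit Types (F G H l : S) (I : S -> Prop) (m : 'X_{1..4}).

Definition colon I l F := I (F * l).
Definition add_gen I l F := exists G H, I G /\ F = G + H * l.

Lemma ideal_sub I F G : ideal I -> I F -> I G -> I (F - G).
Proof. by move=> [I0 ID IM] IF IG; apply: ID => //; rewrite -mulN1r; apply: IM. Qed.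

Lemma ideal_mulr I F G : ideal I -> I F -> I (F * G).
Proof. by case=> _ _ IM IF; rewrite mulrC; apply: IM. Qed.

Lemma ideal_colon I l : ideal I -> ideal (colon I l).
Proof.
move=> idI; have [I0 ID IM] := idI; split; rewrite /colon.
- by rewrite mul0r. - by move=> F G hF hG; rewrite mulrDl; apply: ID.
- by move=> F G hG; rewrite -mulrA; apply: IM.
Qed.

Lemma ideal_add_gen I l : ideal I -> ideal (add_gen I l).
Proof.
case=> I0 ID IM; split.
- by exists 0, 0; rewrite mul0r addr0.
- move=> _ _ [G [H [IG ->]]] [G' [H' [IG' ->]]].
  by exists (G + G'), (H + H'); rewrite mulrDl addrACA; split=> //; apply: ID.
- move=> F _ [G [H [IG ->]]]; exists (F * G), (F * H).
  by rewrite mulrDr mulrA; split=> //; apply: IM.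
Qed.

Lemma sub_add_gen I l F : I F -> add_gen I l F.
Proof. by move=> IF; exists F, 0; rewrite mul0r addr0. Qed.

Lemma gen_add_gen I l H : ideal I -> add_gen I l (H * l).
Proof. by case=> I0 _ _; exists 0, H; rewrite add0r. Qed.

Lemma bihomogeneous_add_gen I a b l :
  bihomogeneous I -> bihom a b l -> bihomogeneous (add_gen I l).
Proof.
move=> hI hl i j _ [G [H [IG ->]]].
rewrite (linearD (bipart i j)) /= (bipartM_bihom _ _ _ hl).
case: ifP => _; [exists (bipart i j G), (bipart (i - a) (j - b) H) |
  exists (bipart i j G), 0]; rewrite ?mul0r; split=> //; exact: hI.
Qed.

(** Membership of a form in I + (l) can be witnessed by forms of the expected
    bidegrees. Since i - a and j - b are truncated, the case where the cofactor
    has to be zero for degree reasons is stated apart. *)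
Lemma add_gen_bihom I a b l i j F :
  bihomogeneous I -> bihom a b l -> bihom i j F -> add_gen I l F ->
  exists G H, [/\ I G, bihom i j G, bihom (i - a) (j - b) H, F = G + H * l
    & ~~ ((a <= i)%N && (b <= j)%N) -> H = 0].
Proof.
move=> hI hl hF [G [H [IG defF]]]; have := bipart_bihom hF.
rewrite {1}defF (linearD (bipart i j)) /= (bipartM_bihom _ _ _ hl).
case: ifP => hab <-; [exists (bipart i j G), (bipart (i - a) (j - b) H) |
  exists (bipart i j G), 0]; rewrite ?mul0r; split=> //;
  by [exact: hI | exact: bihom_bipart | exact: bihom0].
Qed.

Lemma ideal_bihom_le I i j i' j' : ideal I -> (i <= i')%N -> (j <= j')%N ->
  (forall F, bihom i j F -> I F) -> forall F, bihom i' j' F -> I F.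
Proof.
move=> idI hi hj hI; have [I0 ID IM] := idI; apply: bihom_ind => // e m dx dy.
apply: idealZ => //; rewrite -dx in hi; rewrite -dy in hj.
have [m1 [m2 [em d1 d2]]] := mnm_split hi hj.
by rewrite em mpolyXD mulrC; apply: IM; apply: hI; exact: bihomX.
Qed.

(** The exponents that work for the finitely many monomials of bidegree (N, N)
    have a maximum. *)
Lemma saturationK I F : ideal I -> saturation (saturation I) F -> saturation I F.
Proof.
move=> idI [N hN]; have [I0 ID IM] := idI.
have ex_deg (x : 'X_{1..4 < (N + N).+1}) : exists N', degx x = N -> degy x = N ->
    forall G, bihom N' N' G -> I (G * ('X_[x] * F)).
  have [/andP[/eqP dx /eqP dy]|h] := boolP ((degx x == N) && (degy x == N)).
    have [|N' hN'] := hN 'X_[x]; first exact: bihomX.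
    by exists N'.
  by exists 0%N => dx dy; rewrite dx dy eqxx in h.
have [f hf] := fin_all_exists ex_deg.
pose N' := (\max_x f x)%N; exists (N + N')%N => G.
move: G; apply: bihom_ind => [|F1 F2 I1 I2|e m dx dy].
- by rewrite mul0r. - by rewrite mulrDl; apply: ID.
rewrite -scalerAl; apply: idealZ => //.
have hx : (N <= degx m)%N by rewrite dx leq_addr.
have hy : (N <= degy m)%N by rewrite dy leq_addr.
have [m1 [m2 [em d1 d2]]] := mnm_split hx hy.
have lt_m1 : (mdeg m1 < (N + N).+1)%N.
  by rewrite mdeg_degxy d1 d2.
have := hf (BMultinom lt_m1) d1 d2; rewrite em addmC mpolyXD -mulrA => h.
have f_le : (f (BMultinom lt_m1) <= N')%N by exact: leq_bigmax.
apply: (ideal_bihom_le (ideal_colon ('X_[m1] * F) idI) f_le f_le h).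
apply: bihomX; apply: (@addnI N).
  by rewrite -{1}d1 -degxD -em.
by rewrite -{1}d2 -degyD -em.
Qed.

Lemma ideal_saturation I : ideal I -> ideal (saturation I).
Proof.
move=> idI; have [I0 ID IM] := idI; split.
- by exists 0%N => G _; rewrite mulr0.
- move=> F G [N1 h1] [N2 h2]; exists (maxn N1 N2) => A hA; rewrite mulrDr; apply: ID.
    exact: (ideal_bihom_le (ideal_colon F idI) (leq_maxl N1 N2) (leq_maxl N1 N2) h1).
  exact: (ideal_bihom_le (ideal_colon G idI) (leq_maxr N1 N2) (leq_maxr N1 N2) h2).
- by move=> F G [N h]; exists N => A hA; rewrite mulrCA; apply/IM/h.
Qed.

Lemma bihomogeneous_saturation I : bihomogeneous I -> bihomogeneous (saturation I).
Proof.
move=> hI i j F [N h]; exists N => G hG.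
have := hI (i + N)%N (j + N)%N _ (h _ hG).
by rewrite mulrC (bipartM_bihom _ _ _ hG) !leq_addl !addnK mulrC.
Qed.

Lemma sub_saturation I F : ideal I -> I F -> saturation I F.
Proof. by case=> _ _ IM IF; exists 0%N => G _; apply: IM. Qed.

End Ideals.

(** * Dimensions of bigraded pieces *)

Section Dimension.

Variable k : closedFieldType.
Local Notation S := (coord_ring k).
Implicit Types (F G H l : S) (I : S -> Prop) (m : 'X_{1..4}).

Lemma bihom_comb i j d (e : 'I_d -> S) (a : 'I_d -> k) :
  (forall t, bihom i j (e t)) -> bihom i j (\sum_t a t *: e t).
Proof. by move=> he; apply: bihom_sum => t; apply: bihomZ. Qed.

Lemma quotient_dimE I i j d (e : 'I_d -> S) :
  ideal I -> quotient_basis I i j e -> quotient_dim I i j = d.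
Proof.
move=> idI he; have [e' he'] := quotient_dimP i j idI.
exact: quotient_dim_uniq he' he.
Qed.

Lemma quotient_dim_le I I' i j : ideal I -> ideal I' ->
    (forall F, bihom i j F -> I F -> I' F) ->
  (quotient_dim I' i j <= quotient_dim I i j)%N.
Proof.
move=> idI idI' sub; have [e [_ _ spane]] := quotient_dimP i j idI.
have [e' [he' freee' _]] := quotient_dimP i j idI'.
apply: (free_le_span idI (e := e') (e' := e)) => [a Ia|t]; last exact: spane.
by apply/freee'/sub => //; apply: bihom_comb.
Qed.

Lemma quotient_dim_eq I I' i j : ideal I -> ideal I' ->
    (forall F, bihom i j F -> I F <-> I' F) ->
  quotient_dim I i j = quotient_dim I' i j.
Proof.
move=> idI idI' eqI; apply/eqP; rewrite eqn_leq.
by rewrite !quotient_dim_le // => F /eqI[].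
Qed.

(** Comparable subspaces of the same codimension are equal: a form of I' that
    is not in I would be independent, modulo I, of a basis modulo I'. *)
Lemma quotient_dim_eq_sub I I' i j : ideal I -> ideal I' ->
    (forall F, bihom i j F -> I F -> I' F) ->
    (quotient_dim I i j <= quotient_dim I' i j)%N ->
  forall F, bihom i j F -> I' F -> I F.
Proof.
move=> idI idI' sub le_d F hF I'F; apply: NNPP => nIF.
have [e' [he' freee' _]] := quotient_dimP i j idI'.
have [e [_ _ spane]] := quotient_dimP i j idI.
pose f t := oapp e' F (unlift (@ord0 (quotient_dim I' i j)) t).
have hf t : bihom i j (f t) by rewrite /f; case: (unlift ord0 t).
suff: ((quotient_dim I' i j).+1 <= quotient_dim I i j)%N by rewrite ltnNge le_d.
apply: (free_le_span idI (e := f) (e' := e)) => [a|t]; last exact: spane.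
rewrite big_ord_recl {1}/f unlift_none /=.
under eq_bigr do rewrite /f liftK /=.
set E := \sum_t _ => Ia.
have hE : bihom i j E by apply: bihom_comb.
have I'E : I' E.
  have [_ ID _] := idI'; rewrite -[E](addKr (a ord0 *: F)) addrC; apply: ideal_sub => //.
    by apply: sub => //; apply/bihomD => //; apply: bihomZ.
  exact: idealZ.
have a0 t : a (lift ord0 t) = 0 by exact: (freee' (fun t => a (lift ord0 t))).
have E0 : E = 0 by rewrite /E big1 // => t _; rewrite a0 scale0r.
have a00 : a ord0 = 0.
  apply/eqP; apply: contra_notT nIF => nz; move: Ia; rewrite E0 addr0.
  move/(idealZ (a ord0)^-1 idI).
  by rewrite scalerA mulVf // scale1r.
by move=> t; case: (unliftP ord0 t) => [t' ->|->].
Qed.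

Lemma quotient_dim_eq0 I i j : ideal I ->
  (forall F, bihom i j F -> I F) -> quotient_dim I i j = 0%N.
Proof.
move=> idI hI; apply: (quotient_dimE (e := fun=> 0)) => //; split=> [t|a _ []//|F hF].
  exact: bihom0.
by exists (fun=> 0); rewrite big_ord0 subr0; apply: hI.
Qed.

Lemma quotient_dim0_sub I i j : ideal I -> quotient_dim I i j = 0%N ->
  forall F, bihom i j F -> I F.
Proof.
move=> idI d0 F hF; apply: (quotient_dim_eq_sub (I' := fun=> True)) hF _ => //.
by rewrite d0.
Qed.

Lemma quotient_dim_eq1 I i j F0 : ideal I -> bihom i j F0 -> ~ I F0 ->
    (forall F, bihom i j F -> exists a, I (F - a *: F0)) ->
  quotient_dim I i j = 1%N.
Proof.
move=> idI hF0 nIF0 spanF0.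
apply: (quotient_dimE (e := fun _ : 'I_1 => F0)) => //; split=> // [a|F /spanF0[a Ia]].
  rewrite big_ord1 => Ia t; rewrite [t]ord1; apply/eqP.
  apply: contra_notT nIF0 => nz; move: Ia => /(idealZ (a ord0)^-1 idI).
  by rewrite scalerA mulVf // scale1r.
by exists (fun=> a); rewrite big_ord1.
Qed.

(** The exact sequence S / (I : l) -> S / I -> S / (I + (l)): a basis of the
    middle term is obtained from l times a basis of the left term and a basis
    of the right one. *)
Lemma quotient_dim_exact I a b l i j :
    ideal I -> bihomogeneous I -> bihom a b l ->
  quotient_dim I (a + i) (b + j) =
    (quotient_dim (colon I l) i j + quotient_dim (add_gen I l) (a + i) (b + j))%N.
Proof.
move=> idI hI hl; have [I0 ID IM] := idI.
have [e [he freee spane]] := quotient_dimP i j (ideal_colon l idI).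
have [e' [he' freee' spane']] := quotient_dimP (a + i) (b + j) (ideal_add_gen l idI).
set d := quotient_dim _ i j in e he freee spane *.
set d' := quotient_dim _ (a + i) (b + j) in e' he' freee' spane' *.
pose f t := match split t with inl s => e s * l | inr s => e' s end.
have fl s : f (lshift d' s) = e s * l by rewrite /f (unsplitK (inl s)).
have fr s : f (rshift d s) = e' s by rewrite /f (unsplitK (inr s)).
have sumf (u : 'I_(d + d') -> k) : \sum_t u t *: f t =
    (\sum_t u (lshift d' t) *: e t) * l + \sum_t u (rshift d t) *: e' t.
  rewrite big_split_ord mulr_suml; congr (_ + _); apply: eq_bigr => t _.
    by rewrite fl scalerAl.
  by rewrite fr.
apply: (quotient_dimE (e := f)) => //; split.
- move=> t; rewrite /f; case: (split t) => s; last exact: he'.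
  by rewrite addnC [(b + j)%N]addnC; apply: bihomM.
- move=> u; rewrite sumf => Iu.
  have u'0 : forall t, u (rshift d t) = 0.
    apply: (freee' (fun t => u (rshift d t))).
    move: Iu; set A := \sum_t _; set B := \sum_t _ => Iu.
    by exists (A * l + B), (- A); rewrite mulNr addrAC addrN add0r.
  have u0 : forall t, u (lshift d' t) = 0.
    apply: (freee (fun t => u (lshift d' t))).
    by move: Iu; rewrite [X in _ + X]big1 ?addr0 // => t _; rewrite u'0 scale0r.
  by move=> t; rewrite -[t]splitK; case: (split t) => s /=.
- move=> F hF; have [u' hu'] := spane' _ hF.
  have hF' : bihom (a + i) (b + j) (F - \sum_t u' t *: e' t).
    by apply: bihomB => //; apply: bihom_comb.
  have [G [H [IG _ + defF _]]] := add_gen_bihom hI hl hF' hu'.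
  rewrite !addKn => hH; have [u hu] := spane _ hH.
  pose w t := match split t with inl s => u s | inr s => u' s end.
  have wl s : w (lshift d' s) = u s by rewrite /w (unsplitK (inl s)).
  have wr s : w (rshift d s) = u' s by rewrite /w (unsplitK (inr s)).
  exists w; have -> : \sum_t w t *: f t =
      (\sum_t u t *: e t) * l + \sum_t u' t *: e' t.
    by rewrite sumf; congr (_ * _ + _); apply: eq_bigr => t _; rewrite ?wl ?wr.
  rewrite opprD addrCA addrC defF -addrA -mulrBl; exact: ID.
Qed.

Lemma quotient_dim_add_gen_low I a b l i j :
    ideal I -> bihomogeneous I -> bihom a b l -> ~~ ((a <= i) && (b <= j))%N ->
  quotient_dim (add_gen I l) i j = quotient_dim I i j.
Proof.
move=> idI hI hl low; apply: quotient_dim_eq => //; first exact: ideal_add_gen.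
move=> F hF; split=> [IF|IF]; last exact: sub_add_gen.
have [G [H [IG _ _ -> ->]]] := add_gen_bihom hI hl hF IF; last by [].
by rewrite mul0r addr0.
Qed.

End Dimension.

(** * Linear forms and points *)

Lemma ord4_ind (Q : 'I_4 -> Prop) : Q 0 -> Q 1 -> Q 2 -> Q 3 -> forall t, Q t.
Proof.
move=> Q0 Q1 Q2 Q3 [[|[|[|[|t]]]] h] //;
  [move: Q0|move: Q1|move: Q2|move: Q3]; congr Q; exact: val_inj.
Qed.

Section Lines.

Variable k : closedFieldType.
Local Notation S := (coord_ring k).
Implicit Types (F G H l c rho : S) (I : S -> Prop) (m : 'X_{1..4}) (p : qpoint k).

Lemma mnm_degx1 m : degx m = 1%N -> degy m = 0%N ->
  m = U_(0%R)%MM \/ m = U_(1%R)%MM.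
Proof.
rewrite degxE degyE => dx dy; have [m2 m3] : m 2 = 0%N /\ m 3 = 0%N by lia.
have : (m 0 = 1%N /\ m 1 = 0%N) \/ (m 0 = 0%N /\ m 1 = 1%N) by lia.
by case=> [][m0 m1]; [left|right]; apply/mnmP; apply: ord4_ind;
  rewrite ?m0 ?m1 ?m2 ?m3 mnm1E.
Qed.

Lemma mnm_degy1 m : degx m = 0%N -> degy m = 1%N ->
  m = U_(2%R)%MM \/ m = U_(3%R)%MM.
Proof.
rewrite degxE degyE => dx dy; have [m0 m1] : m 0 = 0%N /\ m 1 = 0%N by lia.
have : (m 2 = 1%N /\ m 3 = 0%N) \/ (m 2 = 0%N /\ m 3 = 1%N) by lia.
by case=> [][m2 m3]; [left|right]; apply/mnmP; apply: ord4_ind;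
  rewrite ?m0 ?m1 ?m2 ?m3 mnm1E.
Qed.

Lemma linear_formP (s s' : 'I_4) i j F :
    (forall m, degx m = i -> degy m = j -> m = U_(s)%MM \/ m = U_(s')%MM) ->
  bihom i j F -> exists a b, F = a *: 'X_s + b *: 'X_s'.
Proof.
move=> hm; move: F; apply: bihom_ind => [|F G [a [b ->]] [a' [b' ->]]|e m dx dy].
- by exists 0, 0; rewrite !scale0r addr0.
- by exists (a + a'), (b + b'); rewrite !scalerDl addrACA.
- by case: (hm m dx dy) => ->; [exists e, 0|exists 0, e]; rewrite scale0r ?addr0 ?add0r.
Qed.

Lemma bihom10P F : bihom 1 0 F -> exists a b, F = a *: 'X_0 + b *: 'X_1.
Proof. exact: linear_formP mnm_degx1. Qed.

Lemma bihom01P F : bihom 0 1 F -> exists a b, F = a *: 'X_2 + b *: 'X_3.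
Proof. exact: linear_formP mnm_degy1. Qed.

Lemma meval_lin (s s' : 'I_4) (a b : k) (p : 'I_4 -> k) :
  (a *: 'X_s + b *: 'X_s').@[p] = a * p s + b * p s'.
Proof. by rewrite mevalD !mevalZ !mevalXU. Qed.

(** Two linear forms in two variables with a common nontrivial zero are
    proportional: the determinant of their coefficients kills both coordinates
    of this zero. *)
Lemma linear_form_prop (s s' : 'I_4) (a b a' b' : k) (p : 'I_4 -> k) :
    let l := a *: 'X_s + b *: 'X_s' in let G := a' *: 'X_s + b' *: 'X_s' in
    l != 0 -> (p s != 0) || (p s' != 0) -> l.@[p] = 0 -> G.@[p] = 0 ->
  exists e, G = e *: l.
Proof.
move=> l G l0 p0; rewrite !meval_lin => lp Gp.
have cross : a * b' = a' * b.
  have h1 : (a * b' - a' * b) * p s = 0.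
    rewrite [LHS](_ : _ = b' * (a * p s + b * p s') - b * (a' * p s + b' * p s')).
      by rewrite lp Gp; ring.
    by ring.
  have h2 : (a * b' - a' * b) * p s' = 0.
    rewrite [LHS](_ : _ = a * (a' * p s + b' * p s') - a' * (a * p s + b * p s')).
      by rewrite lp Gp; ring.
    by ring.
  apply/eqP; rewrite -subr_eq0; case/orP: p0 => nz; apply/eqP; apply: (mulIf nz);
  by rewrite mul0r.
have [a0|a0] := eqVneq a 0; last first.
  exists (a' / a); rewrite /G /l scalerDr !scalerA divfK //; congr (_ + _ *: _).
  by apply: (mulfI a0); rewrite cross mulrCA mulrA divfK // mulrC [RHS]mulrC mulrC.
have b0 : b != 0 by apply: contra_neq l0 => b0; rewrite /l a0 b0 !scale0r addr0.
exists (b' / b); rewrite /G /l scalerDr !scalerA divfK // a0 mulr0; congr (_ *: _ + _).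
by apply: (mulIf b0); rewrite -cross a0 !mul0r.
Qed.

Lemma qpoint_x p : (p 0 != 0) || (p 1 != 0).
Proof.
case: (coords_x p) => [[[|[|t]] lt_t] // _ nz]; apply/orP; [left|right];
by rewrite (_ : p _ = p (Ordinal lt_t)) //; congr (p _); apply: val_inj.
Qed.

Lemma qpoint_y p : (p 2 != 0) || (p 3 != 0).
Proof.
case: (coords_y p) => [[[|[|[|[|t]]]] lt_t] // _ nz]; apply/orP; [left|right];
by rewrite (_ : p _ = p (Ordinal lt_t)) //; congr (p _); apply: val_inj.
Qed.

Lemma line10_prop l G p : line10 l -> bihom 1 0 G -> l.@[p] = 0 -> G.@[p] = 0 ->
  exists e, G = e *: l.
Proof.
case=> /bihom10P[a [b ->]] l0 /bihom10P[a' [b' ->]].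
exact: linear_form_prop (qpoint_x p).
Qed.

Lemma line01_prop l G p : line01 l -> bihom 0 1 G -> l.@[p] = 0 -> G.@[p] = 0 ->
  exists e, G = e *: l.
Proof.
case=> /bihom01P[a [b ->]] l0 /bihom01P[a' [b' ->]].
exact: linear_form_prop (qpoint_y p).
Qed.

Lemma line01_span c c' p G : line01 c -> bihom 0 1 c' -> bihom 0 1 G ->
  c.@[p] = 0 -> c'.@[p] != 0 -> exists a b, G = a *: c + b *: c'.
Proof.
move=> hc hc' hG cp c'p; pose b := G.@[p] / c'.@[p].
have [||a e] := line01_prop (G := G - b *: c') hc _ cp.
- by apply: bihomB => //; apply: bihomZ.
- by rewrite mevalB mevalZ divfK // subrr.
by exists a, b; rewrite -e subrK.
Qed.

Lemma line01_common_point c c' p : line01 c -> line01 c' ->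
  c.@[p] = 0 -> c'.@[p] = 0 -> same_locus c c'.
Proof.
move=> hc hc' cp c'p; have [e ec] := line01_prop hc (proj1 hc') cp c'p.
have e0 : e != 0 by apply: contra_neq (proj2 hc') => e0; rewrite ec e0 scale0r.
move=> p'; rewrite ec mevalZ; split=> [->|/eqP]; first by rewrite mulr0.
by rewrite mulf_eq0 (negPf e0) => /eqP.
Qed.

Lemma xform_at p : exists2 T, bihom 1 0 T & T.@[p] = 1.
Proof.
case/orP: (qpoint_x p) => nz; [exists ((p 0)^-1 *: 'X_0)|exists ((p 1)^-1 *: 'X_1)];
  rewrite ?mevalZ ?mevalXU ?mulVf //; apply/bihomZ/bihomX;
  by rewrite ?degxE ?degyE !mnm1E.
Qed.

Lemma yform_at p : exists2 T, bihom 0 1 T & T.@[p] = 1.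
Proof.
case/orP: (qpoint_y p) => nz; [exists ((p 2)^-1 *: 'X_2)|exists ((p 3)^-1 *: 'X_3)];
  rewrite ?mevalZ ?mevalXU ?mulVf //; apply/bihomZ/bihomX;
  by rewrite ?degxE ?degyE !mnm1E.
Qed.

Lemma bihomXn i j d F : bihom i j F -> bihom (i * d) (j * d) (F ^+ d).
Proof. by case/andP=> ? ?; rewrite /bihom !dhomogMn. Qed.

Lemma form_at p i j : exists2 F, bihom i j F & F.@[p] = 1.
Proof.
have [T hT Tp] := xform_at p; have [T' hT' T'p] := yform_at p.
exists (T ^+ i * T' ^+ j); last by rewrite mevalM !rmorphXn /= Tp T'p !expr1n mulr1.
have hx := bihomXn i hT; have hy := bihomXn j hT'.
by have := bihomM hx hy; rewrite !mul1n !mul0n addn0.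
Qed.

Lemma line_point rho c : line10 rho -> line01 c ->
  exists p, rho.@[p] = 0 /\ c.@[p] = 0.
Proof.
case=> /bihom10P[a [b ->]] r0 [/bihom01P[a' [b' ->]] c0].
pose f (t : 'I_4) := nth 0 [:: b; - a; b'; - a'] t.
have fx : exists2 t : 'I_4, (t < 2)%N & f t != 0.
  have [b0|b0] := eqVneq b 0; last by exists 0.
  exists 1 => //; rewrite /f /= oppr_eq0; apply: contra_neq r0 => ->.
  by rewrite b0 !scale0r addr0.
have fy : exists2 t : 'I_4, (2 <= t)%N & f t != 0.
  have [b0|b0] := eqVneq b' 0; last by exists 2.
  exists 3 => //; rewrite /f /= oppr_eq0; apply: contra_neq c0 => ->.
  by rewrite b0 !scale0r addr0.
by exists (QPoint fx fy); rewrite !meval_lin /= /f /=; split; ring.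
Qed.

(** The field being infinite, there is a point of P^1, with coordinates (1, z),
    on none of the given lines; eta is the equation of that point. *)
Lemma line01_avoiding n (c : 'I_n -> S) : (forall t, line01 (c t)) ->
  exists2 eta, line01 eta & forall t p, (c t).@[p] = 0 -> eta.@[p] != 0.
Proof.
move=> hc.
have h t : exists ab : k * k, c t = ab.1 *: 'X_2 + ab.2 *: 'X_3.
  by have [a [b ->]] := bihom01P (proj1 (hc t)); exists (a, b).
have [ab defc] := fin_all_exists h.
pose P : {poly k} := \prod_t ((ab t).1%:P + (ab t).2 *: 'X).
have P0 : P != 0.
  apply/prodf_neq0 => t _; apply: contra_neq (proj2 (hc t)) => /polyP e.
  have := e 0%N; have := e 1%N; rewrite !coefD !coefC !coefZ !coefX /= mulr1 mulr0.
  by rewrite add0r addr0 defc => -> ->; rewrite !scale0r addr0.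
have /closed_nonrootP[z nz] := P0.
have cz t : (ab t).1 + (ab t).2 * z != 0.
  apply: contra nz => /eqP e; rewrite /root /P horner_prod; apply/eqP.
  by rewrite (bigD1 t) //= hornerD hornerC hornerZ hornerX e mul0r.
have eta01 : line01 (z *: 'X_2 + (-1) *: 'X_3 : S).
  split; first by apply: bihomD; apply/bihomZ/bihomX; rewrite ?degxE ?degyE !mnm1E.
  apply/eqP => /(congr1 (meval (fun t : 'I_4 => nth 0 [:: 0; 0; 0; 1] t))).
  by rewrite meval_lin meval0 /= mulr0 add0r mulr1 => /eqP; rewrite oppr_eq0 oner_eq0.
exists (z *: 'X_2 + (-1) *: 'X_3) => // t p; rewrite defc !meval_lin => cp.
apply/eqP => ep; have p3 : p 3 = z * p 2 by rewrite mulN1r in ep; apply/esym/subr0_eq.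
have : ((ab t).1 + (ab t).2 * z) * p 2 = 0 by rewrite mulrDl -mulrA -p3.
move/eqP; rewrite mulf_eq0 (negPf (cz t)) /= => /eqP p2.
by have := qpoint_y p; rewrite p3 p2 mulr0 eqxx.
Qed.

End Lines.

(** * Complete intersections with a line *)

(** The zero ideal, as a start for principal ideals and ideals generated by two
    forms. *)
Definition zero_ideal (k : closedFieldType) : coord_ring k -> Prop :=
  fun F => F = 0.
Notation gen1 l := (add_gen (@zero_ideal _) l).
Notation gen2 l l' := (add_gen (gen1 l) l').

Section CompleteIntersections.

Variable k : closedFieldType.
Local Notation S := (coord_ring k).
Implicit Types (F G H l c rho : S) (I : S -> Prop) (p : qpoint k).

Lemma ideal_zero : ideal (@zero_ideal k).
Proof.
split=> // [F G -> ->|F G ->]; first exact: addr0.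
exact: mulr0.
Qed.

Lemma bihomogeneous_zero : bihomogeneous (@zero_ideal k).
Proof. by move=> i j F ->; exact: linear0. Qed.

Lemma ideal_gen1 l : ideal (gen1 l).
Proof. exact/ideal_add_gen/ideal_zero. Qed.

Lemma ideal_gen2 l l' : ideal (gen2 l l').
Proof. exact/ideal_add_gen/ideal_gen1. Qed.

Lemma bihomogeneous_gen1 a b l : bihom a b l -> bihomogeneous (gen1 l).
Proof. exact/bihomogeneous_add_gen/bihomogeneous_zero. Qed.

Lemma gen1P l F : gen1 l F <-> exists H, F = H * l.
Proof.
split=> [[_ [H [-> ->]]]|[H ->]]; first by exists H; rewrite add0r.
exact/gen_add_gen/ideal_zero.
Qed.

(** Substituting for each variable a congruent one modulo I is congruent to the
    identity modulo I. *)
Lemma comp_congr I (sg : 4.-tuple S) : ideal I ->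
  (forall t, I ('X_t - tnth sg t)) -> forall F, I (F - (F \mPo sg)).
Proof.
move=> idI hI F; have [I0 ID IM] := idI.
have I_mul A B A' B' : I (A - A') -> I (B - B') -> I (A * B - A' * B').
  move=> hA hB.
  have -> : A * B - A' * B' = A * (B - B') + B' * (A - A') by ring.
  by apply: ID; apply: IM.
rewrite comp_mpolyEX [X in X - _]mpolyE -sumrB.
apply: (big_ind I) => // m _; rewrite -scalerBr; apply: idealZ => //.
rewrite comp_mpolyX mpolyXE_id.
apply: (big_ind2 (fun A B => I (A - B))) => [|A A' B B' hA hB|t _].
- by rewrite subrr. - exact: I_mul.
by elim: (m t) => [|d IH]; rewrite ?expr0 ?subrr // !exprS; apply: I_mul.
Qed.

(** Let p be a zero of c and T a linear form in y with value 1 at p. Replacing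
    y0 and y1 by their values at p times T is a ring endomorphism of the domain
    S that kills c and is the identity modulo c, so that its kernel is the
    ideal of c. *)
Lemma gen1_prime c F G : line01 c -> gen1 c (F * G) -> gen1 c F \/ gen1 c G.
Proof.
move=> hc; have [rho hr] : exists rho, line10 rho.
  exists 'X_0; split; last by rewrite -msupp_eq0 msuppX.
  by apply: bihomX; rewrite ?degxE ?degyE !mnm1E.
have [p [_ cp]] := line_point hr hc; have [T hT Tp] := yform_at p.
pose sg := [tuple if (t < 2)%N then 'X_t else p t *: T | t < 4].
have subsg H : gen1 c (H - (H \mPo sg)).
  apply: comp_congr => [|t]; first exact: ideal_gen1.
  rewrite tnth_mktuple; case: ifP => ht.
    by rewrite subrr; case: (ideal_gen1 c).
  have hG : bihom 0 1 ('X_t - p t *: T).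
    apply: bihomB; last exact: bihomZ.
    by apply: bihomX; rewrite ?degxE ?degyE !mnm1E; case: t ht => [[|[|[|[|t]]]]].
  have [|e ->] := line01_prop hc hG cp.
    by rewrite mevalB mevalZ mevalXU Tp mulr1 subrr.
  by apply/gen1P; exists e%:MP; rewrite mul_mpolyC.
have csg : c \mPo sg = 0.
  have [a [b defc]] := bihom01P (proj1 hc); move: cp; rewrite {}defc meval_lin => cp.
  rewrite comp_mpolyD !comp_mpolyZ !comp_mpolyXU -!tnth_nth !tnth_mktuple /=.
  by rewrite !scalerA -scalerDl cp scale0r.
have ker H : gen1 c H <-> H \mPo sg = 0.
  split=> [/gen1P[A ->]|e]; first by rewrite rmorphM /= csg mulr0.
  by have := subsg H; rewrite e subr0.
move/ker/eqP; rewrite rmorphM /= mulf_eq0.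
by case/orP=> /eqP /ker; [left|right].
Qed.

Lemma gen1_low i j l F : bihom i j l -> F != 0 ->
  forall i' j', bihom i' j' F -> ~~ ((i <= i') && (j <= j'))%N -> ~ gen1 l F.
Proof.
move=> hl F0 i' j' hF low IF.
have [G [H [G0 _ _ defF H0]]] := add_gen_bihom bihomogeneous_zero hl hF IF.
by rewrite defF (G0 : G = 0) H0 // mul0r addr0 eqxx in F0.
Qed.

Lemma gen2C l l' F : gen2 l l' F -> gen2 l' l F.
Proof.
case=> _ [H [/gen1P[A ->] ->]]; rewrite addrC; exists (H * l'), A.
by split=> //; apply/gen1P; exists H.
Qed.

Lemma gen2_eval l l' F p : l.@[p] = 0 -> l'.@[p] = 0 -> gen2 l l' F -> F.@[p] = 0.
Proof.
move=> lp l'p [_ [H [/gen1P[A ->] ->]]].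
by rewrite mevalD !mevalM lp l'p !mulr0 addr0.
Qed.

(** Modulo the equations of the two lines through p, a form F of bidegree (i,
    j) is F(p) times a fixed form of this bidegree, as one sees by replacing
    each variable by its value at p times a linear form with value 1 at p. *)
Lemma gen2_point rho c p i j F : line10 rho -> line01 c ->
  rho.@[p] = 0 -> c.@[p] = 0 -> bihom i j F -> F.@[p] = 0 -> gen2 rho c F.
Proof.
move=> hr hc rp cp hF Fp.
have [T hT Tp] := xform_at p; have [T' hT' T'p] := yform_at p.
pose sg := [tuple p t *: (if (t < 2)%N then T else T') | t < 4].
have subsg H : gen2 rho c (H - (H \mPo sg)).
  apply: comp_congr => [|t]; first exact: ideal_gen2.
  rewrite tnth_mktuple; case: ifP => ht.
    have hG : bihom 1 0 ('X_t - p t *: T).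
      apply: bihomB; last exact: bihomZ.
      by apply: bihomX; rewrite ?degxE ?degyE !mnm1E; case: t ht => [[|[|[|[|t]]]]].
    have [|e ->] := line10_prop hr hG rp.
      by rewrite mevalB mevalZ mevalXU Tp mulr1 subrr.
    by apply: sub_add_gen; apply/gen1P; exists e%:MP; rewrite mul_mpolyC.
  have hG : bihom 0 1 ('X_t - p t *: T').
    apply: bihomB; last exact: bihomZ.
    by apply: bihomX; rewrite ?degxE ?degyE !mnm1E; case: t ht => [[|[|[|[|t]]]]].
  have [|e ->] := line01_prop hc hG cp.
    by rewrite mevalB mevalZ mevalXU T'p mulr1 subrr.
  by rewrite -mul_mpolyC; apply/gen_add_gen/ideal_gen1.
suff FE : F \mPo sg = F.@[p] *: (T ^+ i * T' ^+ j).
  by have := subsg F; rewrite FE Fp scale0r subr0.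
move: F hF {Fp}; apply: bihom_ind => [|F G hF hG|e m dx dy].
- by rewrite comp_mpoly0 meval0 scale0r.
- by rewrite comp_mpolyD mevalD scalerDl hF hG.
rewrite comp_mpolyZ mevalZ -scalerA; congr (_ *: _).
rewrite comp_mpolyX mevalX -dx -dy degxE degyE.
under eq_bigr do rewrite tnth_mktuple exprZn.
rewrite scaler_prod; congr (_ *: _).
rewrite !big_ord_recl big_ord0 /= mulr1 !exprD mulrA.
by congr (_ ^+ m _ * _ ^+ m _ * (_ ^+ m _ * _ ^+ m _)); apply: val_inj.
Qed.

(** If I contains the equation of R and a form F0 that is nonzero at the point
    R meets eta, then I + (eta) is everything in the bidegree of F0, since
    modulo rho and eta a form is determined by its value at that point. *)
Lemma add_gen_full I rho eta p i j F0 : ideal I ->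
    line10 rho -> line01 eta -> rho.@[p] = 0 -> eta.@[p] = 0 ->
    (forall F, gen1 rho F -> I F) -> bihom i j F0 -> I F0 -> F0.@[p] != 0 ->
  forall F, bihom i j F -> add_gen I eta F.
Proof.
move=> idI r10 e01 rp ep subI hF0 IF0 F0p F hF.
have idIe := ideal_add_gen eta idI; have [_ ID _] := idIe.
rewrite -(subrK ((F.@[p] / F0.@[p]) *: F0) F); apply: ID; last first.
  by apply: idealZ => //; exact: sub_add_gen.
have : gen2 rho eta (F - (F.@[p] / F0.@[p]) *: F0).
  apply: (gen2_point r10 e01 rp ep (i := i) (j := j)).
    by apply: bihomB => //; apply: bihomZ.
  by rewrite mevalB mevalZ divfK ?subrr.
by case=> G [H [hG ->]]; exists G, H; split; [exact: subI|].
Qed.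

Lemma quotient_dim_gen2_point rho c i j : line10 rho -> line01 c ->
  quotient_dim (gen2 rho c) i j = 1%N.
Proof.
move=> hr hc; have [p [rp cp]] := line_point hr hc; have [F0 hF0 F0p] := form_at p i j.
apply: (quotient_dim_eq1 (F0 := F0)) => //; first exact: ideal_gen2.
  by move/(gen2_eval rp cp)/eqP; rewrite F0p oner_eq0.
move=> F hF; exists F.@[p]; apply: (gen2_point hr hc rp cp (i := i) (j := j)).
  by apply: bihomB => //; apply: bihomZ.
by rewrite mevalB mevalZ F0p mulr1 subrr.
Qed.

(** The coordinate ring of a (0, 1)-line is that of P^1 in the variables x:
    each multiplication by x0 adds one to the dimension, the quotient being the
    coordinate ring of a point. *)
Lemma quotient_dim_line c i j : line01 c -> quotient_dim (gen1 c) i j = i.+1.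
Proof.
move=> hc; have hr : line10 ('X_0 : S).
  split; last by rewrite -msupp_eq0 msuppX.
  by apply: bihomX; rewrite ?degxE ?degyE !mnm1E.
have hg := bihomogeneous_gen1 (proj1 hc).
have id1 := ideal_gen1 c.
have point i' : quotient_dim (gen2 c 'X_0) i' j = 1%N.
  rewrite -[RHS](quotient_dim_gen2_point i' j hr hc).
  by apply: quotient_dim_eq => [||F _]; try exact: ideal_gen2; split; apply: gen2C.
elim: i => [|i IH].
  by rewrite -(quotient_dim_add_gen_low id1 hg (proj1 hr)).
have := quotient_dim_exact i j id1 hg (proj1 hr).
rewrite add1n add0n point addn1 => ->; congr _.+1; rewrite -IH.
apply: quotient_dim_eq => //; first exact: ideal_colon.
move=> F hF; split=> [/(gen1_prime hc)[//|]|]; last exact: ideal_mulr.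
by move/(gen1_low (proj1 hc) (proj2 hr) (proj1 hr)); case.
Qed.

(** The lines are treated one at a time: if F = H * f modulo rho, where f is
    the product for the preceding points, then H vanishes at the next point, f
    being nonzero there. *)
Lemma gen2_points (n : nat) rho (c : 'I_n -> S) (pt : 'I_n -> qpoint k)
    (s : seq 'I_n) i j F :
    line10 rho -> (forall t, line01 (c t)) -> (forall t, rho.@[pt t] = 0) ->
    (forall t, (c t).@[pt t] = 0) -> (forall t t', t != t' -> (c t).@[pt t'] != 0) ->
    uniq s -> bihom i j F -> (forall t, t \in s -> F.@[pt t] = 0) ->
  gen2 rho (\prod_(t <- s) c t) F.
Proof.
move=> hr hc rp cp cp'; elim: s => [_ _ _|t s IH].
  by rewrite big_nil -[F]mulr1; apply/gen_add_gen/ideal_gen1.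
rewrite [uniq _]/= => /andP[ts us] hF Fp.
have IHF := IH us hF (fun t' t's => Fp t' (mem_behead (s := t :: s) t's)).
have hf : bihom 0 (size s) (\prod_(t <- s) c t).
  elim: (s) => [|t' s' IHs]; first by rewrite big_nil; exact: bihom1.
  rewrite big_cons; exact: (bihomM (proj1 (hc t')) IHs).
have [_ [H [/gen1P[A ->] _ hH defF _]]] :=
  add_gen_bihom (bihomogeneous_gen1 (proj1 hr)) hf hF IHF.
have Hp : H.@[pt t] = 0.
  have := Fp t (mem_head _ _); rewrite defF mevalD !mevalM rp mulr0 add0r => /eqP.
  rewrite mulf_eq0 => /orP[/eqP //|/eqP /esym fp].
  have: (\prod_(t' <- s) c t').@[pt t] != 0.
    rewrite rmorph_prod /= big_seq prodf_seq_neq0; apply/allP => t' t's /=.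
    by rewrite t's; apply: cp'; apply: contraNneq ts => <-.
  by rewrite -fp eqxx.
have [_ [H' [/gen1P[A' ->] defH]]] := gen2_point hr (hc t) (rp t) (cp t) hH Hp.
exists ((A + A' * \prod_(t <- s) c t) * rho), H'; split.
  by apply/gen1P; exists (A + A' * \prod_(t <- s) c t).
by rewrite defF defH big_cons; ring.
Qed.

End CompleteIntersections.

(** * Sections of a scheme by lines *)

Section Schemes.

Variable k : closedFieldType.
Local Notation S := (coord_ring k).
Implicit Types (F G H l c rho eta : S) (I : S -> Prop) (X : subscheme k) (p : qpoint k).

Lemma ideal_section X l : ideal (section_ideal X l).
Proof. exact/ideal_saturation/ideal_add_gen/ideal_ofP. Qed.

Lemma section_sub X l F : X F -> section_ideal X l F.
Proof.
move=> XF; apply: sub_saturation; first exact/ideal_add_gen/ideal_ofP.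
exact: sub_add_gen.
Qed.

Lemma section_gen X l F : section_ideal X l (F * l).
Proof.
apply: sub_saturation; first exact/ideal_add_gen/ideal_ofP.
exact/gen_add_gen/ideal_ofP.
Qed.

Lemma section_sat X l F :
  saturation (section_ideal X l) F -> section_ideal X l F.
Proof. exact/saturationK/ideal_add_gen/ideal_ofP. Qed.

Lemma bihomogeneous_section X a b l :
  bihom a b l -> bihomogeneous (section_ideal X l).
Proof.
move=> hl; apply: bihomogeneous_saturation.
exact: bihomogeneous_add_gen (@ideal_of_bihom _ X) hl.
Qed.

(** If R does not meet X then I(X) + (rho) contains a power of the irrelevant
    ideal, so that modulo any saturated ideal containing I(X) some power of the
    irrelevant ideal consists of multiples of rho. It is needed both for I(X)
    and for the ideals of sections of X. *)
Lemma disjoint_nonzerodivisor X rho I F : disjoint_line X rho ->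
    ideal I -> (forall G, X G -> I G) -> (forall G, saturation I G -> I G) ->
  I (F * rho) -> I F.
Proof.
case=> N dN idI XI satI IFr; apply: satI.
have [N' hN'] : section_ideal X rho 1.
  apply: section_sat; exists N => G hG; rewrite mulr1.
  by apply: (quotient_dim0_sub (ideal_section X rho) (dN N N _ _)) hG.
exists N' => G /hN'; rewrite mulr1 => -[A [H [XA ->]]].
have [_ ID IM] := idI; rewrite mulrDl; apply: ID.
  by rewrite mulrC; apply/IM/XI.
by rewrite -mulrA [rho * F]mulrC; apply: IM.
Qed.

Section LineSection.

Variables (X : subscheme k) (c rho eta : S) (q : nat).
Hypothesis c01 : line01 c.
Hypothesis r10 : line10 rho.
Hypothesis e01 : line01 eta.
Hypothesis c_eta : forall p, c.@[p] = 0 -> eta.@[p] != 0.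
Hypothesis rX : disjoint_line X rho.
Hypothesis qP : points_on_line X c q.
Let Y := section_ideal X c.

Let idY : ideal Y := ideal_section X c.
Let bihY : bihomogeneous Y := bihomogeneous_section (proj1 c01).

(** The section ideal contains c and is saturated, while c and eta span the
    forms of bidegree (0, 1): a form killed by eta is killed by the ideal (y0,
    y1). *)
Lemma section_eta_nzd F : Y (F * eta) -> Y F.
Proof.
move=> YFe; apply: section_sat; exists 1%N => G hG.
have [p [_ cp]] := line_point r10 c01; have [_ YD YM] := idY.
rewrite -/Y -/(colon Y F G).
apply: (@ideal_bihom_le _ _ 0 1 1 1) hG => //; first exact: ideal_colon.
move=> {}G hG; have [a [b ->]] := line01_span c01 (proj1 e01) hG cp (c_eta cp).
rewrite /colon mulrDl -!scalerAl; apply: YD; apply: idealZ => //; rewrite mulrC //.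
exact: section_gen.
Qed.

(** A section of X by a (0, 1)-line is a subscheme of P^1, embedded by the
    variables x; this removes the degree in y from the discussion. *)
Lemma section_dim_y i j : quotient_dim Y i j = quotient_dim Y i 0.
Proof.
elim: j => // j <-.
have := quotient_dim_exact i j idY bihY (proj1 e01).
rewrite add0n add1n => ->; rewrite [X in (_ + X)%N]quotient_dim_eq0 ?addn0; last 2 first.
- exact: ideal_add_gen.
- apply: (@ideal_bihom_le _ _ 0 1) => //; first exact: ideal_add_gen.
  have [p [_ cp]] := line_point r10 c01.
  move=> G hG; have [a [b ->]] := line01_span c01 (proj1 e01) hG cp (c_eta cp).
  exists (a *: c), b%:MP; rewrite mul_mpolyC; split=> //.
  by rewrite -mul_mpolyC; apply: section_gen.
apply: quotient_dim_eq => //; first exact: ideal_colon.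
move=> F hF; split; [exact: section_eta_nzd|exact: ideal_mulr].
Qed.

Lemma section_dim_large : exists N, forall i, (N <= i)%N -> quotient_dim Y i 0 = q.
Proof.
by case: qP => N hN; exists N => i hi; rewrite -(section_dim_y i N); apply: hN.
Qed.

Lemma section_dim_x i :
  quotient_dim Y i.+1 0 = (quotient_dim Y i 0 + quotient_dim (add_gen Y rho) i.+1 0)%N.
Proof.
have := quotient_dim_exact i 0 idY bihY (proj1 r10).
rewrite add1n addn0 => ->; congr addn; apply: quotient_dim_eq => //.
  exact: ideal_colon.
move=> F hF; split; last exact: ideal_mulr.
apply: (disjoint_nonzerodivisor rX) => //; [exact: section_sub|exact: section_sat].
Qed.

(** The dimensions of S / Y in bidegrees (i, 0) increase to q, by steps equal
    to the dimensions of S / (Y + (rho)). Were the step at i = q nonzero, so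
    would be the steps at 0, ..., q - 1, and the limit would be at least q + 1.
    Geometrically: the section of X by C lies on a union of (1, 0)-lines of
    degree q that does not contain R. *)
Lemma section_add_rho F : bihom q 0 F -> add_gen Y rho F.
Proof.
have idYr := ideal_add_gen rho idY.
apply: quotient_dim0_sub => //; apply/eqP; apply/negPn/negP => dim_neq0.
have dim_gt0 i : (i <= q)%N -> (0 < quotient_dim (add_gen Y rho) i 0)%N.
  move=> le_iq; rewrite lt0n; apply: contra dim_neq0 => /eqP d0.
  apply/eqP/quotient_dim_eq0 => //.
  exact: (ideal_bihom_le idYr le_iq (leqnn 0) (quotient_dim0_sub idYr d0)).
have dim_ge i : (i <= q)%N -> (i < quotient_dim Y i 0)%N.
  elim: i => [|i IH] hi.
    rewrite -(quotient_dim_add_gen_low idY bihY (proj1 r10)) //; exact: dim_gt0.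
  by rewrite section_dim_x; have := IH (ltnW hi); have := dim_gt0 _ hi; lia.
have mono d : (quotient_dim Y q 0 <= quotient_dim Y (d + q) 0)%N.
  elim: d => // d IH; rewrite addSn section_dim_x; lia.
have [N hN] := section_dim_large.
by have := mono N; rewrite (hN (N + q)%N) ?leq_addr // leqNgt dim_ge.
Qed.

(** If c does not divide F, then F cuts a scheme of degree i on the line C =
    P^1 of equation c; it contains the section of X by C, whence q <= i. *)
Lemma scheme_line_dvd i j F : (i < q)%N -> X F -> bihom i j F -> gen1 c F.
Proof.
move=> lt_iq XF hF; apply: NNPP => nF.
have [N hN] := section_dim_large.
have id1 := ideal_gen1 c.
have hcF := quotient_dim_exact N 0 id1 (bihomogeneous_gen1 (proj1 c01)) hF.
have colonE : quotient_dim (colon (gen1 c) F) N 0 = N.+1.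
  rewrite -(quotient_dim_line N 0 c01); apply: quotient_dim_eq => //.
    exact: ideal_colon.
  by move=> G hG; split=> [/(gen1_prime c01)[]|] //; apply: ideal_mulr.
have le_q : (q <= quotient_dim (add_gen (gen1 c) F) (i + N) (j + 0))%N.
  rewrite -(hN (i + N)%N) ?leq_addl // -(section_dim_y _ (j + 0)).
  apply: quotient_dim_le => //; first exact: ideal_add_gen.
  have [_ YD YM] := idY.
  move=> G _ [_ [H [/gen1P[A ->] ->]]]; apply: YD; first exact: section_gen.
  exact/YM/section_sub.
rewrite (quotient_dim_line _ _ c01) colonE in hcF; lia.
Qed.

End LineSection.

End Schemes.

(** * Adding points on a line disjoint from the scheme *)

Section HilbertTable.

Variable k : closedFieldType.
Local Notation S := (coord_ring k).
Implicit Types (F G H l : S) (I : S -> Prop).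

(** The Hilbert matrix of an ideal, with value 0 at negative indices: rows and
    columns of index -1 need no separate treatment. *)
Definition dim_table I (i j : int) : int :=
  match i, j with
  | Posz i', Posz j' => (quotient_dim I i' j')%:Z
  | _, _ => 0
  end.

Lemma dim_table_eq I I' (i : nat) (j : int) : ideal I -> ideal I' ->
    (forall j F, bihom i j F -> I F <-> I' F) ->
  dim_table I i j = dim_table I' i j.
Proof. by move=> idI idI' h; case: j => //= j; rewrite (quotient_dim_eq idI idI' (h j)). Qed.

Lemma dim_table_exact I K a b l (i j : int) :
    ideal I -> bihomogeneous I -> ideal K -> bihom a b l ->
    (forall i j F, bihom i j F -> I (F * l) <-> K F) ->
  dim_table I i j = dim_table K (i - a%:Z) (j - b%:Z) + dim_table (add_gen I l) i j.
Proof.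
move=> idI hI idK hl hK.
have neg i' j' : (i' < 0) || (j' < 0) -> dim_table K i' j' = 0.
  by case: i' j' => [i'|i'] [j'|j'].
case: i => [i|i]; last by rewrite neg ?add0r //=; lia.
case: j => [j|j]; last by rewrite neg ?add0r //=; lia.
have [|low] := boolP ((a <= i) && (b <= j))%N; last first.
  by rewrite neg ?add0r /= ?(quotient_dim_add_gen_low _ _ hl low) //; lia.
case/andP=> /subnKC <- /subnKC <-; rewrite !PoszD ![_ + _ - _]addrC !addKr /=.
rewrite (quotient_dim_exact _ _ idI hI hl) PoszD; congr (_%:Z + _).
by apply: quotient_dim_eq => [||F hF]; [exact: ideal_colon | done | exact: hK hF].
Qed.

End HilbertTable.

Lemma card_ord_lt m r : (m <= r)%N -> #|[set v : 'I_r | (v < m)%N]| = m.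
Proof.
move=> le_mr; rewrite cardsE -sum1_card (big_ord_narrow le_mr).
by rewrite sum_nat_const card_ord muln1.
Qed.

Lemma initial_segment r (A : {set 'I_r}) :
    (forall u v : 'I_r, (u <= v)%N -> v \in A -> u \in A) ->
  forall u, (u \in A) = (u < #|A|)%N.
Proof.
move=> down u.
apply/idP/idP => [uA|lt_u].
  rewrite -[u.+1](@card_ord_lt _ r) //; apply/subset_leq_card/subsetP => v.
  by rewrite inE ltnS => le_vu; apply: down uA.
apply: contraLR lt_u => uA; rewrite -leqNgt -[leqRHS](@card_ord_lt _ r); last exact/ltnW.
apply/subset_leq_card/subsetP => v vA; rewrite inE ltnNge.
by apply: contra uA => /down; apply.
Qed.

Section Configuration.

Variables (k : closedFieldType) (X : subscheme k) (b n r : nat).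
Local Notation S := (coord_ring k).
Implicit Types (F G H : S) (A : {set 'I_r}) (p : qpoint k).
Variables (rho : S) (c : 'I_n.+1 -> S) (s : 'I_r -> 'I_n.+1) (q : 'I_r -> nat).
Hypothesis r10 : line10 rho.
Hypothesis rX : disjoint_line X rho.
Hypothesis c01 : forall i, line01 (c i).
Hypothesis c_distinct : forall i i', i != i' -> ~ same_locus (c i) (c i').
Hypothesis Xc : X (\prod_(i < n.+1 | (i <= b)%N) c i).
Hypothesis s_inj : injective s.
Hypothesis qP : forall t, points_on_line X (c (s t)) (q t).
Hypothesis q_mono : forall t t' : 'I_r, (t <= t')%N -> (q t <= q t')%N.

Variable eta : S.
Hypothesis e01 : line01 eta.
Hypothesis c_eta : forall t (p : qpoint k), (c t).@[p] = 0 -> eta.@[p] != 0.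

Variable pt : 'I_n.+1 -> qpoint k.
Hypothesis pt_rho : forall t, rho.@[pt t] = 0.
Hypothesis pt_c : forall t, (c t).@[pt t] = 0.

Let J := add_gen X rho.
Let lines_off (A : {set 'I_r}) := \prod_(t in ~: (s @: A)) c t.
Let idX := ideal_ofP X.
Let idJ : ideal J := ideal_add_gen rho idX.
Let bihJ : bihomogeneous J := bihomogeneous_add_gen (@ideal_of_bihom _ X) (proj1 r10).

Lemma common_point_neq t t' p : t != t' -> (c t).@[p] = 0 -> (c t').@[p] != 0.
Proof.
move=> neq_tt' cp; apply/eqP => c'p; apply: (c_distinct neq_tt').
exact: line01_common_point (c01 t) (c01 t') cp c'p.
Qed.

Lemma pt_neq t t' : t != t' -> (c t).@[pt t'] != 0.
Proof. by rewrite eq_sym => /common_point_neq; apply. Qed.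

Lemma bihom_lines_off A : bihom 0 #|~: (s @: A)| (lines_off A).
Proof. by apply: bihom_prod01 => t; case: (c01 t). Qed.

Lemma card_lines_off (A : {set 'I_r}) : #|~: (s @: A)| = (n.+1 - #|A|)%N.
Proof. by rewrite cardsCs setCK card_imset // card_ord. Qed.

Lemma card_le A : (#|A| <= n.+1)%N.
Proof. by rewrite -(card_imset (mem A) s_inj) -[leqRHS]card_ord max_card. Qed.

Lemma lines_offD1 A u : u \in A -> lines_off (A :\ u) = c (s u) * lines_off A.
Proof.
move=> uA; rewrite /lines_off (_ : ~: _ = s u |: ~: (s @: A)).
  by rewrite big_setU1 // inE negbK imset_f.
apply/setP => t; rewrite !inE -[t == _]negbK -negb_and; congr (~~ _).
apply/imsetP/andP => [[v /setD1P[vu vA] ->]|[tu /imsetP[v vA et]]].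
  by rewrite (inj_eq s_inj) vu imset_f.
by exists v; rewrite // in_setD1 vA andbT -(inj_eq s_inj) -et.
Qed.

Lemma scheme_nzd F : X (F * rho) -> X F.
Proof. by apply: (disjoint_nonzerodivisor rX) => //; apply: ideal_of_sat. Qed.

(** The rows of the difference table of X are the first differences of the
    Hilbert functions of S / (I(X) + (rho)). *)
Lemma hilbert_diff_restrict (i j : int) :
  hilbert_diff X i j = dim_table J i j - dim_table J i (j - 1).
Proof.
have step j' : hilbert_matrix X i j' = hilbert_matrix X (i - 1) j' + dim_table J i j'.
  rewrite -[in RHS](subr0 j'); rewrite -!/(dim_table X _ _).
  rewrite (_ : dim_table J i (j' - 0) = dim_table J i j') ?subr0 //.
  rewrite [LHS](dim_table_exact _ _ idX (@ideal_of_bihom _ X) idX (proj1 r10)) ?subr0 //.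
  by move=> ? ? F _; split; [exact: scheme_nzd | exact: ideal_mulr].
by rewrite /hilbert_diff (step j) (step (j - 1)); ring.
Qed.

Lemma lines_off_set0 : X (lines_off set0).
Proof.
rewrite /lines_off imset0 setC0 (eq_bigl xpredT) => [|t]; last by rewrite inE.
by rewrite (bigID (fun t : 'I_n.+1 => (t <= b)%N)) /=; apply: ideal_mulr.
Qed.

(** The scheme X is contained in the union of its section by C_(s u) and of the
    other lines. *)
Lemma lines_off_section u G : section_ideal X (c (s u)) G -> X (lines_off [set u] * G).
Proof.
case=> N hN; apply: ideal_of_sat; exists N => D /hN[A [H [XA e]]].
rewrite mulrCA e mulrDr; have [_ ID IM] := idX; apply: ID; first exact: IM.
have := lines_offD1 (set11 u); rewrite setDv => e0.
by rewrite mulrCA [lines_off _ * _]mulrC -e0; apply/IM/lines_off_set0.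
Qed.

(** The case of one line: by [section_add_rho] the form H is, modulo rho, a
    form containing the section of X by C_(s u). *)
Lemma lines_off_restrict1 i u H : (q u <= i)%N -> bihom i 0 H ->
  J (lines_off [set u] * H).
Proof.
move=> le_qi hH.
have c_eta_su := @c_eta (s u).
have := section_add_rho (c01 _) r10 e01 c_eta_su rX (@qP u).
move/(ideal_bihom_le (ideal_add_gen rho (ideal_section X (c (s u)))) le_qi (leqnn 0)).
case/(_ _ hH) => G [K [YG ->]]; exists (lines_off [set u] * G), (lines_off [set u] * K).
by split; [exact: lines_off_section | rewrite mulrDr mulrA].
Qed.

Lemma lines_off_neq0 A p : eta.@[p] = 0 -> (lines_off A).@[p] != 0.
Proof.
move=> ep; rewrite /lines_off rmorph_prod /=; apply/prodf_neq0 => t _.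
by apply/eqP => /c_eta; rewrite ep eqxx.
Qed.

(** Since the dimensions agree, multiplication by eta on S / (I(X) + (rho)) is
    injective as soon as it is surjective. It is surjective because I(X) +
    (rho) contains the product over the complement of A \ u, which does not
    vanish at the point R meets eta. And eta is a combination of c (s u) and c
    (s u'), which both multiply the product for A into I(X) + (rho). *)
Lemma lines_off_restrict_step i (A : {set 'I_r}) u u' : u \in A -> u' \in A -> u != u' ->
    quotient_dim J i (n.+1 - #|A|).+1 = quotient_dim J i (n.+1 - #|A|) ->
    (forall H, bihom i 0 H -> J (lines_off (A :\ u) * H)) ->
    (forall H, bihom i 0 H -> J (lines_off (A :\ u') * H)) ->
  forall H, bihom i 0 H -> J (lines_off A * H).
Proof.
rewrite -card_lines_off; set j := #|_| => uA u'A neq_u eq_dim Ju Ju' H hH.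
have hfH : bihom i j (lines_off A * H).
  by rewrite -[j]addn0; apply: bihomM (bihom_lines_off A) hH.
apply: (quotient_dim_eq_sub (I' := colon J eta)) hfH _ => //.
- exact: ideal_colon. - by move=> F _; apply: ideal_mulr.
- have := quotient_dim_exact i j idJ bihJ (proj1 e01); rewrite add0n add1n eq_dim => ->.
  suff /(quotient_dim_eq0 (ideal_add_gen eta idJ)) -> :
      forall F, bihom i j.+1 F -> add_gen J eta F.
    by rewrite addn0.
  have [p [rp ep]] := line_point r10 e01; have [T hT Tp] := form_at p i 0.
  apply: (add_gen_full idJ r10 e01 rp ep (F0 := lines_off (A :\ u) * T)); last 2 first.
  + exact: Ju.
  + by rewrite mevalM Tp mulr1; apply: lines_off_neq0.
  + by move=> _ /gen1P[K ->]; apply: gen_add_gen.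
  rewrite (_ : j.+1 = #|~: (s @: (A :\ u))| + 0)%N.
    exact: bihomM (bihom_lines_off _) hT.
  by rewrite /j !card_lines_off; have := cardsD1 u A; rewrite uA; have := card_le A; lia.
(* c (s u) and c (s u') have no common zero: they span the (0, 1)-forms *)
have suu' : s u' != s u by rewrite (inj_eq s_inj) eq_sym.
have [a [a' ->]] := line01_span (c01 (s u)) (proj1 (c01 (s u'))) (proj1 e01)
  (pt_c (s u)) (pt_neq suu').
have [_ ID _] := idJ; rewrite /colon mulrDr -!scalerAr; apply: ID; apply: idealZ => //.
- by have := Ju H hH; rewrite lines_offD1 // -mulrA mulrC.
- by have := Ju' H hH; rewrite lines_offD1 // -mulrA mulrC.
Qed.

Hypothesis diff0 : forall t : 'I_r, (1 <= t)%N -> forall i : nat, (q t <= i)%N ->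
  hilbert_diff X i (n - t + 1)%N = 0.

(** Induction on the number of lines in A. If A has m >= 2 elements, the
    largest of them is at least m - 1, so that q (m - 1) <= i and the
    difference table of X vanishes at (i, n - m + 2). *)
Lemma lines_off_restrict i A H : (forall u, u \in A -> (q u <= i)%N) ->
  bihom i 0 H -> J (lines_off A * H).
Proof.
have [d] := ubnP #|A|; elim: d A H => // d IH A H; rewrite ltnS => leA qA hH.
have [A0|[u uA]] := set_0Vmem A.
  by rewrite A0; apply: sub_add_gen; apply: ideal_mulr lines_off_set0.
have [A'0|[u' u'A]] := set_0Vmem (A :\ u).
  by rewrite -(setD1K uA) A'0 setU0; exact: lines_off_restrict1 (qA u uA) hH.
move/setD1P: u'A => [neq_u u'A].
have IHD v : v \in A -> forall H, bihom i 0 H -> J (lines_off (A :\ v) * H).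
  move=> vA {H hH} H hH; apply: IH => [|w /setD1P[_ /qA]//|//].
  by have := cardsD1 v A; rewrite vA; lia.
apply: (lines_off_restrict_step uA u'A _ _ (IHD u uA) (IHD u' u'A) hH).
  by rewrite eq_sym.
have A_gt1 : (1 < #|A|)%N by rewrite (cardsD1 u) uA (cardsD1 u') in_setD1 neq_u u'A.
have le_Ar : (#|A| <= r)%N by rewrite -[leqRHS]card_ord max_card.
have lt_tr : (#|A|.-1 < r)%N by lia.
pose t := Ordinal lt_tr.
(* A has more elements than there are indices below t *)
have [v vA le_tv] : exists2 v, v \in A & (t <= v)%N.
  apply/exists_inP; apply: contraT => /exists_inPn no_v.
  have : (A \subset [set v : 'I_r | (v < t)%N]).
    by apply/subsetP => v /no_v; rewrite inE -ltnNge.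
  move/subset_leq_card; rewrite card_ord_lt /= ?(ltnW lt_tr) //.
  by rewrite -ltnS prednK ?ltnn // ltnW.
have t1 : (1 <= t)%N by rewrite -ltnS prednK // ltnW.
have := diff0 t1 (leq_trans (q_mono le_tv) (qA v vA)).
rewrite hilbert_diff_restrict (_ : (n - t + 1)%N = (n.+1 - #|A|).+1); last first.
  by move: (card_le A) A_gt1; rewrite /t /=; move: #|A| => m; lia.
have -> : (n.+1 - #|A|).+1%:Z - 1 = (n.+1 - #|A|)%N.
  by rewrite intS addrAC subrr add0r.
by move/eqP; rewrite subr_eq0 => /eqP[].
Qed.

Lemma lines_off_restrict_dvd i j A H : (forall u, u \in A -> (q u <= i)%N) ->
  bihom i j H -> J (H * lines_off A).
Proof.
move=> qA hH; apply: (ideal_bihom_le (ideal_colon (lines_off A) idJ) (leqnn i) (leq0n j)) hH.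
by move=> {}H hH; rewrite /colon mulrC; apply: lines_off_restrict hH.
Qed.

Let P : qpoint k -> Prop := fun p =>
  rho.@[p] = 0 /\ exists2 i, i \notin codom s & (c i).@[p] = 0.
Let W := union X (reduced_points P).
Let A_ i := [set u : 'I_r | (q u <= i)%N].

Lemma union_colon F : W (F * rho) <-> X F.
Proof.
split=> [[XFr _]|XF]; first exact: scheme_nzd.
split; first exact: ideal_mulr.
move=> p [rp _] i j; rewrite (bipartM_bihom _ _ _ (proj1 r10)).
by case: ifP => _; rewrite ?meval0 // mevalM rp mulr0.
Qed.

Lemma gen2_lines_offP i j F A : bihom i j F ->
  (gen2 rho (lines_off A) F <-> forall t, t \in ~: (s @: A) -> F.@[pt t] = 0).
Proof.
move=> hF; split=> [h t tA|h].
  apply: gen2_eval (pt_rho t) _ h; rewrite /lines_off rmorph_prod /= (bigD1 t) //=.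
  by rewrite pt_c mul0r.
rewrite /lines_off -big_enum; apply: (gen2_points r10 c01 pt_rho pt_c pt_neq) hF _.
  exact: enum_uniq.
by move=> t; rewrite mem_enum; apply: h.
Qed.

(** The ideal of W restricted to R. From left to right: a form of I(W) vanishes
    at the added points by definition, and is divisible by the other lines in
    the product because its degree in x is too small. From right to left: the
    lift to I(X) of a multiple of the product vanishes at the added points,
    since it coincides with this multiple on R. *)
Lemma union_restrict i j F : bihom i j F ->
  (add_gen W rho F <-> gen2 rho (lines_off (A_ i)) F).
Proof.
move=> hF; split=> [WF|].
  have [G [H [[XG PG] hG _ defF _]]] :=
    add_gen_bihom (@ideal_of_bihom _ W) (proj1 r10) hF WF.
  apply/(gen2_lines_offP _ hF) => t; rewrite inE => tA.
  rewrite defF mevalD mevalM pt_rho mulr0 addr0.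
  have [/codomP[u etu]|ts] := boolP (t \in codom s).
    have lt_iq : (i < q u)%N.
      by rewrite ltnNge; apply: contra tA => le_qi; rewrite etu imset_f // inE.
    have := scheme_line_dvd (c01 _) r10 e01 (@c_eta (s u)) (@qP u) lt_iq XG hG.
    by case/gen1P => K ->; rewrite mevalM etu pt_c mulr0.
  have Pt : P (pt t) by split; [exact: pt_rho | exists t; [exact: ts | exact: pt_c]].
  by have := PG (pt t) Pt i j; rewrite bipart_bihom.
move=> Ff; have [_ [H [/gen1P[A ->] _ hH defF _]]] :=
  add_gen_bihom (bihomogeneous_gen1 (proj1 r10)) (bihom_lines_off (A_ i)) hF Ff.
rewrite subn0 in hH.
have JHf : J (H * lines_off (A_ i)).
  by apply: (lines_off_restrict_dvd _ hH) => u; rewrite inE.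
have Fpt := proj1 (gen2_lines_offP (A_ i) hF) Ff.
have JF : J F.
  by have [_ ID _] := idJ; rewrite defF; apply: ID => //; apply: gen_add_gen.
have [G [K [XG hG _ defF' _]]] :=
  add_gen_bihom (@ideal_of_bihom _ X) (proj1 r10) hF JF.
exists G, K; split=> //; split=> // p [rp [t ts cp]] i' j'.
have [[-> ->]|neq_ij] := eqVneq (i', j') (i, j); last first.
  by rewrite (bipart_bihom_neq hG) ?meval0 //; apply: negbTE.
rewrite bipart_bihom //.
have -> : G.@[p] = F.@[p] by rewrite defF' mevalD mevalM rp mulr0 addr0.
rewrite defF mevalD !mevalM rp mulr0 add0r.
have tA : t \in ~: (s @: A_ i).
  by rewrite inE; apply: contra ts => /imsetP[u _ ->]; apply: codom_f.
by rewrite /lines_off rmorph_prod /= (bigD1 t tA) /= cp mul0r mulr0.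
Qed.

(** The coordinate ring of m distinct points of R = P^1: eta vanishes at none
    of them, and modulo eta there remains the coordinate ring of one point in
    the degrees in which the product, of degree m, is not available. *)
Lemma gen2_lines_off_diff (i j : nat) A :
  dim_table (gen2 rho (lines_off A)) i j -
    dim_table (gen2 rho (lines_off A)) i (j%:Z - 1) =
    (j < n.+1 - #|A|)%N.
Proof.
have hg : bihomogeneous (gen2 rho (lines_off A)).
  exact: bihomogeneous_add_gen (bihomogeneous_gen1 (proj1 r10)) (bihom_lines_off A).
have idg := ideal_gen2 rho (lines_off A).
have colonE i' j' F : bihom i' j' F ->
    (gen2 rho (lines_off A) (F * eta) <-> gen2 rho (lines_off A) F).
  move=> hF; split; last exact: ideal_mulr.
  move/(gen2_lines_offP A (bihomM hF (proj1 e01))) => h.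
  apply/(gen2_lines_offP A hF) => t tA; have /eqP := h t tA.
  by rewrite mevalM mulf_eq0 (negPf (c_eta (pt_c t))) orbF => /eqP.
rewrite (dim_table_exact i j idg hg idg (proj1 e01) colonE) subr0 addrAC subrr add0r.
rewrite -card_lines_off /=; case: leqP => [le_j|lt_j].
  rewrite quotient_dim_eq0 //; first exact: ideal_add_gen.
  have [p [rp ep]] := line_point r10 e01.
  have [T hT Tp] := form_at p i (j - #|~: (s @: A)|).
  apply: (add_gen_full idg r10 e01 rp ep (F0 := T * lines_off A)).
  - exact: sub_add_gen.
  - by have := bihomM hT (bihom_lines_off A); rewrite addn0 subnK.
  - exact/gen_add_gen/ideal_gen1.
  - by rewrite mevalM Tp mul1r; apply: lines_off_neq0.
suff -> : quotient_dim (add_gen (gen2 rho (lines_off A)) eta) i j = 1%N by [].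
rewrite -[RHS](quotient_dim_gen2_point i j r10 e01).
apply: quotient_dim_eq => [||F hF]; [exact: ideal_add_gen|exact: ideal_gen2|].
split=> [Fg|[_ [H [/gen1P[K ->] ->]]]]; last first.
  by exists (K * rho), H; split=> //; apply/sub_add_gen/gen1P; exists K.
have [G [H [Gg hG _ -> _]]] := add_gen_bihom hg (proj1 e01) hF Fg.
have [G' [K [G'r _ _ defG K0]]] :=
  add_gen_bihom (bihomogeneous_gen1 (proj1 r10)) (bihom_lines_off A) hG Gg.
exists G, H; split=> //; rewrite defG K0 ?mul0r ?addr0 //.
by rewrite leq0n leqNgt lt_j.
Qed.

(** The rows i and i - 1 of the correction come from the two products, over the
    complements of A_ i and A_ (i - 1). *)
Lemma hilbert_diff_union (i j : nat) :
  hilbert_diff W i j = hilbert_diff X (i%:Z - 1) j + (j < n.+1 - #|A_ i|)%N%:Z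
    - (if i is i'.+1 then (j < n.+1 - #|A_ i'|)%N else 0%N)%:Z.
Proof.
have step (i' : int) j' :
    hilbert_matrix W i' j' =
      hilbert_matrix X (i' - 1) j' + dim_table (add_gen W rho) i' j'.
  rewrite -[in RHS](subr0 j') -!/(dim_table _ _ _).
  rewrite [LHS](dim_table_exact _ _ (ideal_ofP W) (@ideal_of_bihom _ W) idX
    (proj1 r10)) ?subr0 //.
  by move=> i0 j0 F _; exact: union_colon.
have tabE (i' : nat) j' : dim_table (add_gen W rho) i' j' =
    dim_table (gen2 rho (lines_off (A_ i'))) i' j'.
  apply: dim_table_eq; [exact/ideal_add_gen/ideal_ofP|exact: ideal_gen2|].
  by move=> j0 F hF; apply: union_restrict hF.
rewrite /hilbert_diff !step -(gen2_lines_off_diff i j) -!tabE.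
case: i => [|i].
  by rewrite /= subr0; ring.
rewrite -(gen2_lines_off_diff i j) -!tabE intS [1 + _]addrC addrK; ring.
Qed.

Hypothesis q_gt0 : forall t, (0 < q t)%N.

(** As q is nondecreasing, A_ i consists of the first indices; in row i, the
    two brackets of [hilbert_diff_union] differ at the columns n - u, for u in
    A_ i but not in A_ (i - 1), that is, q u = i. In row 0, A_ 0 is empty
    because each of the lines meets X. *)
Lemma hilbert_diff_unionE (i j : nat) :
  hilbert_diff W i j =
    if i == 0%N then (if (j <= n)%N then 1 else 0)
    else if (i, j) \in [seq (q t, (n - t)%N) | t : 'I_r]
    then hilbert_diff X (i%:Z - 1) j - 1 else hilbert_diff X (i%:Z - 1) j.
Proof.
have le_rn : (r <= n.+1)%N by rewrite -[r]card_ord -cardsT card_le.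
have memA i' (u : 'I_r) : (q u <= i')%N = (u < #|A_ i'|)%N.
  rewrite -initial_segment ?inE // => v w le_vw; rewrite !inE.
  exact: leq_trans (q_mono le_vw).
have leA i' : (#|A_ i'| <= r)%N by rewrite -[leqRHS]card_ord max_card.
rewrite hilbert_diff_union; case: i => [|i].
  rewrite (_ : A_ 0 = set0) ?cards0 ?subn0.
    by rewrite /hilbert_diff /= ltnS; case: (j <= n)%N.
  by apply/setP => u; rewrite !inE leqn0 -[q u == _]negbK -lt0n q_gt0.
rewrite [_.+1 == _]/=; have le_m := leA i.+1.
have le_mm : (#|A_ i| <= #|A_ i.+1|)%N.
  by apply/subset_leq_card/subsetP => u; rewrite !inE; apply: leqW.
case: ifP => [|notT].
  case/imageP=> t _ [eq_q ->]; have := memA i.+1 t; have := memA i t.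
  rewrite -eq_q leqnn ltnn => /esym/negbT; rewrite -leqNgt => le_t /esym lt_t.
  have -> : (n - t < n.+1 - #|A_ i.+1|)%N = false by lia.
  have -> : (n - t < n.+1 - #|A_ i|)%N = true by lia.
  by rewrite addr0.
suff -> : (j < n.+1 - #|A_ i.+1|)%N = (j < n.+1 - #|A_ i|)%N by rewrite addrK.
apply/idP/idP => [|lt_j]; first lia.
rewrite ltnNge; apply/negP => le_j; have lt_r : (n - j < r)%N by lia.
(* the brackets differ, so that j = n - u for an index u new in A_ i.+1 *)
pose u := Ordinal lt_r; case/imageP: notT; exists u => //.
have := memA i.+1 u; have := memA i u; rewrite /=.
have -> : (n - j < #|A_ i|)%N = false by lia.
have -> : (n - j < #|A_ i.+1|)%N = true by lia.
move=> /negbT; rewrite -ltnNge => h1 h2.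
congr (_, _); first by apply/eqP; rewrite eqn_leq h1 h2.
by rewrite /=; lia.
Qed.

End Configuration.

(* [rho] is the form of R, [c i] the form of C_i; [s t] and [q t], for
   t = 0, ..., r - 1, are the i_k and q_k of k = t + 1, so that
   n - k + 1 = n - t and n - k + 2 = n - t + 1. *)
Theorem corollary3 (k : closedFieldType) (X : subscheme k) (a b n r : nat)
    (rho : coord_ring k) (c : 'I_n.+1 -> coord_ring k)
    (s : 'I_r -> 'I_n.+1) (q : 'I_r -> nat) :
  zero_dimensional X ->
  diff_size X a b ->
  line10 rho ->
  disjoint_line X rho ->
  (b <= n)%N ->
  (forall i, line01 (c i)) ->
  (forall i i', i != i' -> ~ same_locus (c i) (c i')) ->
  X (\prod_(i < n.+1 | (i <= b)%N) c i) ->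
  (forall i : 'I_n.+1, (i <= b)%N ->
     exists2 d, (0 < d)%N & points_on_line X (c i) d) ->
  injective s ->
  (forall t, (s t <= b)%N) ->
  (forall t, points_on_line X (c (s t)) (q t)) ->
  (forall t t' : 'I_r, (t <= t')%N -> (q t <= q t')%N) ->
  let P : qpoint k -> Prop := fun p =>
    rho.@[p] = 0 /\ exists2 i, i \notin codom s & (c i).@[p] = 0 in
  let W := union X (reduced_points P) in
  let T : seq (nat * nat) := [seq (q t, (n - t)%N) | t : 'I_r] in
  r = 1%N \/
  ((2 <= r)%N /\
   forall t : 'I_r, (1 <= t)%N -> forall i : nat, (q t <= i)%N ->
     hilbert_diff X i (n - t + 1)%N = 0) ->
  forall i j : nat,
    hilbert_diff W i j =
      if i == 0%N then (if (j <= n)%N then 1 else 0)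
      else if (i, j) \in T then hilbert_diff X (i%:Z - 1) j - 1
      else hilbert_diff X (i%:Z - 1) j.
Proof.
move=> _ _ r10 rX _ c01 c_distinct Xc c_pos s_inj s_le qP q_mono P W T cond.
have diff0 (t : 'I_r) : (1 <= t)%N -> forall i : nat, (q t <= i)%N ->
    hilbert_diff X i (n - t + 1)%N = 0.
  case: cond => [r1|[_]]; last exact.
  by have := ltn_ord t; rewrite [X in (_ < X)%N]r1; case: (nat_of_ord t).
have q_gt0 t : (0 < q t)%N.
  have [d d_gt0 [N hN]] := c_pos _ (s_le t); have [N' hN'] := qP t.
  pose M := maxn N N'; have <- : quotient_dim (section_ideal X (c (s t))) M M = q t.
    by apply: hN'; apply: leq_maxr.
  by rewrite hN ?leq_maxl.
have [eta e01 c_eta] := line01_avoiding c01.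
have [pt pt_line] := fin_all_exists (fun t => line_point r10 (c01 t)).
have [pt_rho pt_c] := all_and2 pt_line.
exact: (hilbert_diff_unionE r10 rX c01 c_distinct Xc s_inj qP q_mono e01 c_eta
  pt_rho pt_c diff0 q_gt0).
Qed.
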